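(* Let $n\geq 2$. If every poset with property $\mathrm{K}_n$ has property $\mathrm{K}_{n+1}$, then $\mathrm{MA}_{\omega_1}(\mathrm{K}_n)$ holds.
   Context: A poset is a partially ordered set. A subset $X$ of a poset $\mathcal{P}$ is $n$-linked (for $n\ge 2$) if every $n$-element subset of $X$ has a common lower bound in $\mathcal{P}$. For $n\ge 2$, $\mathcal{P}$ has property $\mathrm{K}_n$ if every uncountable subset of $\mathcal{P}$ has an uncountable $n$-linked subset. For a property $\Phi$ of posets implying the countable chain condition, $\mathrm{MA}_{\omega_1}(\Phi)$ is the assertion that for every poset $\mathcal{P}$ with property $\Phi$ and every collection $\mathcal{X}$ of $\omega_1$ many dense subsets of $\mathcal{P}$ there is a filter $G\subseteq\mathcal{P}$ with $G\cap D\ne\emptyset$ for all $D\in\mathcal{X}$. Here dense means downward cofinal, and a filter is an upward closed subset any finitely many elements of which have a common lower bound in it. *)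

(* Defs.v *)
From mathcomp Require Import all_boot all_order.
From mathcomp Require Import all_classical.
From mathcomp Require wochoice.

Set Implicit Arguments.
Unset Strict Implicit.
Unset Printing Implicit Defensive.

Local Open Scope classical_set_scope.
Local Open Scope card_scope.

Section Poset.
Context {d : Order.disp_t} {P : porderType d}.
Implicit Types (X D G F : set P) (n : nat).

Definition linked n X : Prop :=
  forall F, F `<=` X -> F #= `I_n -> has_lbound F.

Definition dense_below D : Prop := forall p : P, exists2 q, D q & (q <= p)%O.

(* The case F = set0 of the second clause makes every filter nonempty. *)
Definition is_filter G : Prop :=
  (forall p q : P, G p -> (p <= q)%O -> G q) /\
  (forall F, finite_set F -> F `<=` G -> exists2 p, G p & lbound F p).

End Poset.

Definition property_K (n : nat) (d : Order.disp_t) (P : porderType d) : Prop :=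
  forall X : set P, ~ countable X ->
    exists Y : set P, [/\ Y `<=` X, ~ countable Y & linked n Y].

(* A has cardinality at most omega_1: it can be well-ordered in such a way that
   every proper initial segment is countable, i.e. in order type at most
   omega_1.  The relation R is reflexive and well-orders the whole type T,
   which is no restriction since a well-order of A extends to one of T. *)
Definition card_le_omega1 (T : Type) (A : set T) : Prop :=
  exists2 R : rel T, wochoice.well_order R &
    forall x, A x -> countable [set y | A y /\ R y x].

(* P is required to be nonempty: an empty poset has no filter, as filters are
   nonempty.  Families of omega_1 many dense sets may have repetitions, whence
   "at most omega_1". *)
Definition MA_omega1 (Phi : forall d : Order.disp_t, porderType d -> Prop) :
    Prop :=
  forall (d : Order.disp_t) (P : porderType d), inhabited P -> Phi d P ->
  forall X : set (set P), card_le_omega1 X ->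
    (forall D, X D -> dense_below D) ->
    exists2 G : set P, is_filter G & forall D, X D -> G `&` D !=set0.

(* Main.v *)
Require Import Defs.
From HB Require Import structures.
From mathcomp Require Import finmap.
From mathcomp Require Import all_boot all_order.
From mathcomp Require Import all_classical.
From mathcomp Require wochoice.

Set Implicit Arguments.
Unset Strict Implicit.
Unset Printing Implicit Defensive.

Local Open Scope classical_set_scope.

(** The step from K_n to K_n+1 is applied to posets of finite sets.  If
    amalgamating [n] finite sets with a hereditary property never destroys the
    property, at least after passing to uncountably many of them, then these
    conditions have K_n, hence K_n+1, and an uncountable set of points has all
    its [n.+1]-element subsets good ([amalgamation]).  The case used most often
    is [coherent_subset]: given relations, one for each level, such that any
    two points are related from some level on, there is an uncountable set
    without [n.+1] pairwise unrelated points at any level.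

    Applied to the level where two sequences of integers split, this gives an
    uncountable subfamily of any family of omega_1 sequences that is bounded by
    one sequence ([bounded_values]).  Applied to tree orders of height at most
    omega whose union is the order of omega_1 (a [ladder]), it gives trees with
    at most [n] branches, which thin out to one branch, uncountably many
    points following it ([single_branch]).  Along one branch, the finite
    objects that a point determines at each level are nested, and this already
    gives [pseudo_intersection].

    Let P have K_n and let [p] be a family of omega_1 elements of P.  It is a
    countable union of subfamilies in which every [n] elements have a lower
    bound ([sigma_linked]): one climbs from [r] to [r.+1] elements with the
    amalgamation of configurations made of [r.+1] points and of [n - r] further
    points that serve as padding.  It is even a countable union of centered
    families ([sigma_centered]): to bound many points at once, one descends
    through the tree orders along a single branch; at each level only [n]
    maximal points are left, and their bounds can be taken in one [n]-linked
    class.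

    Finally, a Loewenheim closure ([countable_closures]) gives omega_1 elements
    of P closed under lower bounds and meeting the given dense sets below each
    of them.  For such a sigma-centered family the argument of Bell
    ([generic]) gives a generic centered set: choose integers that code the
    classes, one after the other, in the pseudo-intersections of the sets of
    codes where all requirements can be met, and large enough for all the
    omega_1 many requirements, which is possible as one sequence dominates all
    their demands.  Countably many dense sets are met by a descending
    sequence. *)

(** * Uncountable sets *)

Lemma uncountableS (T : Type) (A B : set T) :
  A `<=` B -> ~ countable A -> ~ countable B.
Proof. by move=> AB ucA cB; apply: ucA; apply: sub_countable cB; apply: subset_card_le. Qed.

Lemma uncountable_fiber (T : Type) (C : countType) (f : T -> C) (A : set T) :
  ~ countable A -> exists c, ~ countable (A `&` [set x | f x = c]).
Proof.
move=> ucA; apply: contrapT => /forallNP cf; apply: ucA.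
have -> : A = \bigcup_(c in [set: C]) (A `&` [set x | f x = c]).
  by apply/seteqP; split=> [x Ax|x [c _ []//]]; exists (f x).
by apply: bigcup_countable => // c _; apply: contrapT; apply: cf.
Qed.

Lemma uncountable_image (T U : Type) (f : T -> U) (A : set T) :
  {in A &, injective f} -> ~ countable A -> ~ countable (f @` A).
Proof.
move=> /inj_card_eq fA ucA cfA; apply: ucA; apply: sub_countable cfA.
by move: fA; rewrite card_eq_le => /andP[].
Qed.

Lemma uncountableD (T : Type) (A B : set T) :
  ~ countable A -> countable B -> ~ countable (A `\` B).
Proof.
move=> ucA cB cAB; apply: ucA.
have -> : A = \bigcup_(b in [set: bool]) (if b then A `&` B else A `\` B).
  apply/seteqP; split=> [x Ax|x [[] _ []//]].
  by case: (pselect (B x)) => Bx; [exists true|exists false].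
apply: bigcup_countable => // -[] _ //.
by apply: sub_countable cB; apply: subset_card_le => x [].
Qed.

Lemma uncountable_ex (T : Type) (A : set T) : ~ countable A -> exists x, A x.
Proof.
move=> ucA; apply: contrapT => /forallNP A0; apply: ucA.
by have -> : A = set0 by apply/seteqP; split=> x // /A0.
Qed.

Lemma uncountable_ex_notin (T : choiceType) (A : set T) (s : seq T) :
  ~ countable A -> exists2 x, A x & x \notin s.
Proof.
move=> ucA; have cs : countable [set` s].
  by apply: finite_set_countable; apply: finite_seq.
by have [x [Ax /negP xs]] := uncountable_ex (uncountableD ucA cs); exists x.
Qed.

Lemma uncountable_seq (T : choiceType) (A : set T) (s0 : seq T) m :
  ~ countable A -> exists s, [/\ uniq s, size s = m, {in s, forall x, A x}
    & {in s, forall x, x \notin s0}].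
Proof.
move=> ucA; elim: m => [|m [s [us ss sA s0s]]]; first by exists [::].
have [x Ax] := uncountable_ex_notin (s ++ s0) ucA.
rewrite mem_cat negb_or => /andP[xs xs0].
exists (x :: s); split; rewrite /= ?xs ?ss//.
- by move=> y; rewrite inE => /predU1P[->//|/sA].
- by move=> y; rewrite inE => /predU1P[->//|/s0s].
Qed.

(** * Linked sets and lists *)

Section Bounded.
Context {d : Order.disp_t} {P : porderType d}.
Implicit Types (s : seq P) (X : set P).

Definition bounded s := exists q : P, {in s, forall x, (q <= x)%O}.

Lemma boundedS s1 s2 : {subset s1 <= s2} -> bounded s2 -> bounded s1.
Proof. by move=> s12 [q qs]; exists q => x /s12/qs. Qed.

Lemma bounded_nseq s p : {in s, forall x, x = p} -> bounded s.
Proof. by move=> sp; exists p => x /sp ->. Qed.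

Lemma linked_seqP n X : linked n X <->
  (forall s, uniq s -> size s = n -> {in s, forall x, X x} -> bounded s).
Proof.
split=> lX.
- move=> s us ss sX; have [||q qs] := lX [set` s]; first by move=> x /sX.
    have -> : [set` s] = [set` [fset x in s]%fset].
      by apply/seteqP; split=> x /=; rewrite inE.
    by apply/card_eq_fsetP; rewrite card_fseq undup_id.
  by exists q => x xs; apply: qs.
- move=> F FX Fn; have [s0 Fs0] : exists s, F = [set` s].
    by apply/finite_seqP/finite_setP; exists n.
  have Fs : F = [set` undup s0].
    by rewrite Fs0; apply/seteqP; split=> x /=; rewrite mem_undup.
  have [|||q qs] := lX (undup s0).
  + exact: undup_uniq.
  + have F' : F = [set` [fset x in s0]%fset].
      by rewrite Fs0; apply/seteqP; split=> x /=; rewrite inE.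
    by move: Fn; rewrite F' => /card_eq_fsetP; rewrite card_fseq.
  + by move=> x xs; apply: FX; rewrite Fs.
  + by exists q => x; rewrite Fs => /qs.
Qed.

Lemma linked_le n X s : linked n X -> ~ countable X -> size s <= n ->
  {in s, forall x, X x} -> bounded s.
Proof.
move=> /linked_seqP lX ucX sn sX.
have [t [ut st tX tNs]] := uncountable_seq s (n - size (undup s)) ucX.
apply: (@boundedS _ (undup s ++ t)).
  by move=> x xs; rewrite mem_cat mem_undup xs.
apply: lX.
- rewrite cat_uniq undup_uniq ut andbT; apply/hasPn => x /tNs.
  by rewrite /= mem_undup.
- by rewrite size_cat st subnKC// (leq_trans (size_undup s)).
- by move=> x; rewrite mem_cat mem_undup => /orP[/sX|/tX].
Qed.

(** Property K_n for families: repetitions are harmless, since either a value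
    is repeated uncountably often or an uncountable subfamily is injective. *)
Lemma property_K_family n (V : choiceType) (q : V -> P) (I : set V) :
  property_K n P -> ~ countable I ->
  exists J : set V, [/\ J `<=` I, ~ countable J &
    forall s : seq V, size s <= n -> {in s, forall x, J x} -> bounded (map q s)].
Proof.
move=> KP ucI; case: (pselect (exists p, ~ countable (I `&` [set x | q x = p]))).
  move=> [p ucp]; exists (I `&` [set x | q x = p]).
  split=> [x []//|//|s _ sJ].
  by apply: (@bounded_nseq _ p) => _ /mapP[x /sJ[_ xp] ->].
move=> /forallNP cq; have ucqI : ~ countable (q @` I).
  move=> cqI; apply: ucI.
  have -> : I = \bigcup_(p in q @` I) (I `&` [set x | q x = p]).
    by apply/seteqP; split=> [x Ix|x [p _ []//]]; exists (q x) => //; exists x.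
  by apply: bigcup_countable => // p _; apply: contrapT; apply: cq.
have [Y [YI ucY lY]] := KP _ ucqI.
have [x0 _] := uncountable_ex ucI.
have /choice[g gP] : forall p, exists x, Y p -> I x /\ q x = p.
  move=> p; case: (pselect (Y p)) => [/YI[x Ix xp]|nYp]; first by exists x.
  by exists x0 => /nYp.
exists (g @` Y); split.
- by move=> _ [p Yp <-]; case: (gP p Yp).
- move=> cgY; apply: ucY; apply: sub_countable (cgY).
  apply: card_le_trans (card_image_le q (g @` Y)); apply: subset_card_le => p Yp.
  by exists (g p); [exists p|case: (gP p Yp)].
- move=> s sn sJ; apply: (linked_le lY ucY); first by rewrite size_map.
  by move=> _ /mapP[x /sJ[p Yp <-] ->]; case: (gP p Yp) => _ ->.
Qed.

Lemma property_K_families n (V : choiceType) (E : eqType) (q : E -> V -> P)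
  (I : set V) (es : seq E) : property_K n P -> ~ countable I ->
  exists J : set V, [/\ J `<=` I, ~ countable J &
    forall e (s : seq V), e \in es -> size s <= n -> {in s, forall x, J x} ->
      bounded (map (q e) s)].
Proof.
move=> KP ucI; elim: es => [|e es [J [JI ucJ lJ]]]; first by exists I; split.
have [J' [J'J ucJ' lJ']] := property_K_family (q e) KP ucJ.
exists J'; split=> [|//|e' s]; first exact: subset_trans JI.
rewrite inE => /predU1P[->|e's] sn sJ'; first exact: lJ'.
by apply: lJ => // x /sJ'/J'J.
Qed.

End Bounded.

(** * Amalgamation *)

(** Larger conditions are stronger.  The order is put on an alias, as finite
    sets already carry the order of inclusion. *)
Definition condition (V : choiceType) (good : {fset V} -> Prop) :=
  {F : {fset V} | `[< good F >]}.

Section Condition.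
Context {V : choiceType} {good : {fset V} -> Prop}.
Local Notation T := (condition good).

HB.instance Definition _ := Choice.on T.

Definition condition_le (F G : T) := (val G `<=` val F)%fset.

Lemma condition_le_refl : reflexive condition_le.
Proof. by move=> F; apply: fsubset_refl. Qed.

Lemma condition_le_anti : antisymmetric condition_le.
Proof.
move=> F G; rewrite /condition_le => /andP[GF FG]; apply: val_inj; apply/eqP.
by rewrite eqEfsubset FG.
Qed.

Lemma condition_le_trans : transitive condition_le.
Proof. by move=> G F E FG GE; apply: fsubset_trans GE FG. Qed.

HB.instance Definition _ := Order.Le_isPOrder.Build Order.default_display T
  condition_le_refl condition_le_anti condition_le_trans.

End Condition.

Definition K_step (n : nat) :=
  forall (d : Order.disp_t) (P : porderType d),
    property_K n P -> property_K n.+1 P.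

(** The amalgamation of [n] conditions makes the poset of conditions K_n, and
    K_n+1 for the family of singletons makes every set of [n.+1] points of an
    uncountable set good. *)
Lemma amalgamation n (V : choiceType) (good : {fset V} -> Prop) (I0 : set V) :
  K_step n ->
  (forall F G, (G `<=` F)%fset -> good F -> good G) ->
  (forall X : set {fset V}, ~ countable X -> (forall F, X F -> good F) ->
    exists Y : set {fset V}, [/\ Y `<=` X, ~ countable Y &
      forall (s : seq {fset V}) U, size s = n -> {in s, forall F, Y F} ->
        {in U, forall x, exists2 F, F \in s & x \in F} -> good U]) ->
  (forall x, I0 x -> good [fset x]%fset) ->
  ~ countable I0 ->
  exists I, [/\ I `<=` I0, ~ countable I &
    forall s, uniq s -> size s = n.+1 -> {in s, forall x, I x} ->
      good [fset x in s]%fset].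
Proof.
move=> hK gS gU g1 ucI0.
have KT : property_K n (condition good).
  move=> X ucX; have ucvX : ~ countable [set val F | F in X].
    by apply: uncountable_image => // F G _ _; apply: val_inj.
  have [|Y [YX ucY YU]] := gU _ ucvX.
    by move=> _ [F _ <-]; exact: (asboolW (valP F)).
  exists (X `&` [set F | Y (val F)]); split; first by move=> F [].
    move=> cY; apply: ucY; apply: sub_countable cY.
    apply: card_le_trans (card_image_le val _); apply: subset_card_le => F YF.
    by have [G XG GF] := YX _ YF; exists G => //; split=> //=; rewrite GF.
  apply/linked_seqP => s us ss sX.
  pose U : {fset V} := (\bigcup_(F <- s) val F)%fset.
  have gUU : `[< good U >].
    apply/asboolP; apply: (YU [seq val F | F <- s]); rewrite ?size_map//.
      by move=> _ /mapP[F /sX[_ YF] ->].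
    move=> x /bigfcupP[F /andP[Fs _] xF].
    by exists (val F) => //; apply: map_f.
  exists (Sub U gUU : condition good) => F Fs; apply/fsubsetP => x xF.
  by rewrite SubK; apply/bigfcupP; exists F => //; rewrite Fs.
have /choice[g gP] : forall x, exists F : condition good, I0 x -> val F = [fset x]%fset.
  have [x0 Ix0] := uncountable_ex ucI0.
  have mk x : I0 x -> {F : condition good | val F = [fset x]%fset}.
    by move=> /g1/asboolP gx; exists (exist _ [fset x]%fset gx).
  move=> x; case: (pselect (I0 x)) => [/mk[F Fx]|nIx]; first by exists F.
  by have [F _] := mk _ Ix0; exists F => /nIx.
have g_inj : {in I0 &, injective g}.
  move=> x y /set_mem Ix /set_mem Iy xy; apply: fset1_inj.
  by rewrite -gP// -gP// xy.
have ucgI0 : ~ countable (g @` I0) by apply: uncountable_image.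
have [Y [YI ucY /linked_seqP lY]] := hK _ _ KT _ ucgI0.
exists (I0 `&` [set x | Y (g x)]); split; first by move=> x [].
  move=> cY; apply: ucY; apply: sub_countable cY.
  apply: card_le_trans (card_image_le g _); apply: subset_card_le => F YF.
  by have [x Ix xF] := YI _ YF; exists x => //; split=> //=; rewrite xF.
move=> s us ss sI; have [|||q qs] := lY (map g s).
- by rewrite map_inj_in_uniq// => x y /sI[Ix _] /sI[Iy _]; apply: g_inj; apply: mem_set.
- by rewrite size_map.
- by move=> _ /mapP[x /sI[_ Yx] ->].
apply: gS (_ : good (val q)); last exact: (asboolW (valP q)).
apply/fsubsetP => x; rewrite inE => xs; have [Ix _] := sI _ xs.
by have /fsubsetP := qs _ (map_f g xs); apply; rewrite gP// inE.
Qed.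

(** * Coherent subsets *)

Lemma eventually_all (T : eqType) (s : seq T) (Q : T -> nat -> Prop) :
  {in s, forall x, exists l, forall k, l <= k -> Q x k} ->
  exists l, forall k, l <= k -> {in s, forall x, Q x k}.
Proof.
elim: s => [|x s IHs] sQ; first by exists 0.
have [|l lQ] := IHs; first by move=> y ys; apply: sQ; rewrite inE ys orbT.
have [m mQ] := sQ _ (mem_head x s).
exists (maxn l m) => k; rewrite geq_max => /andP[lk mk] y.
by rewrite inE => /predU1P[->|ys]; [apply: mQ|apply: lQ].
Qed.

Lemma pigeonhole_seq (T U : eqType) (f : T -> U) (u : seq T) (s : seq U) :
  uniq u -> size s < size u -> {in u, forall x, f x \in s} ->
  exists x y, [/\ x \in u, y \in u, x != y & f x = f y].
Proof.
move=> uu su fs; apply: contrapT => nf.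
have : uniq (map f u).
  rewrite map_inj_in_uniq// => x y xu yu fxy; apply: contrapT => /eqP xy.
  by apply: nf; exists x, y.
move=> /uniq_leq_size sle; have : size (map f u) <= size s.
  by apply: sle => _ /mapP[x xu ->]; apply: fs.
by rewrite size_map leqNgt su.
Qed.

Definition initial (C : Type) (V : Type) (t : nat -> V -> C) l x :=
  [seq t k x | k <- iota 0 l].

Lemma initialP (C : eqType) (V : Type) (t : nat -> V -> C) l x y :
  initial t l x = initial t l y <-> forall k, k < l -> t k x = t k y.
Proof.
split=> [/eq_in_map xy k kl|xy].
  by apply: (xy k); rewrite mem_iota.
by apply/eq_in_map => k; rewrite mem_iota /= => /xy.
Qed.

(** Amalgamate [n] conditions that look alike up to a level from which on all
    points of a condition are related to each other.  Above this level,
    [n.+1] points of the amalgam contain two of the same condition, which are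
    related.  Below it, each point looks like the point with the same place in
    one fixed condition, which copies the configuration into this condition. *)
Lemma coherent_subset n (V : choiceType) (C : countType) (t : nat -> V -> C)
  (r : nat -> rel V) (I0 : set V) : K_step n -> 1 < n ->
  (forall k x x' y y', t k x = t k x' -> t k y = t k y' -> r k x y = r k x' y') ->
  (forall k x, r k x x) ->
  (forall x y, exists l, forall k, l <= k -> r k x y) ->
  ~ countable I0 ->
  exists I, [/\ I `<=` I0, ~ countable I &
    forall k s, uniq s -> size s = n.+1 -> {in s, forall x, I x} ->
      exists x y, [/\ x \in s, y \in s, x != y & r k x y]].
Proof.
move=> hK n1 r_inv r_refl r_far ucI0.
pose good (F : {fset V}) := forall k s, uniq s -> size s = n.+1 ->
  {subset s <= F} -> exists x y, [/\ x \in s, y \in s, x != y & r k x y].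
have [||x Ix k s us ss sx|//|I [II0 ucI gI]] := @amalgamation n V good I0 hK.
- move=> F G /fsubsetP GF gF k s us ss sG.
  by apply: gF => // x /sG/GF.
- move=> X ucX Xgood.
  have /choice[l lP] : forall F : {fset V}, exists l, forall k, l <= k ->
      {in F &, forall x y, r k x y}.
    move=> F; have [l lF] : exists l, forall k, l <= k ->
        {in enum_fset F, forall x, {in enum_fset F, forall y, r k x y}}.
      apply: (@eventually_all _ _ (fun x k => {in enum_fset F, forall y, r k x y})).
      move=> x _; apply: (@eventually_all _ _ (fun y k => r k x y)) => y _.
      exact: r_far.
    by exists l => k /lF lk x y xF yF; apply: lk.
  pose code F := (l F, [seq initial t (l F) x | x <- enum_fset F]).
  have [[l0 cl] ucY] := uncountable_fiber code ucX.
  set Y := _ `&` _ in ucY; exists Y; split=> //; first by move=> F [].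
  move=> s U ss sY sU k u uu su uU.
  have /choice[f fP] : forall x, exists F, x \in u -> F \in s /\ x \in F.
    move=> x; case: (boolP (x \in u)) => [/uU/sU[F Fs xF]|_]; first by exists F.
    by exists fset0.
  (* from level l0 on, two of the n.+1 points share a condition *)
  case: (leqP l0 k) => [lk|kl].
    have [||x [y [xu yu xy fxy]]] := @pigeonhole_seq _ _ f u s uu.
    - by rewrite ss su.
    - by move=> x /fP[].
    exists x, y; split=> //; have [Fs xF] := fP _ xu; have [_ yF] := fP _ yu.
    have [_ [lF _]] := sY _ Fs; apply: (lP (f x)) => //; last by rewrite fxy.
    by rewrite lF.
  (* below level l0, the points are moved into the condition F *)
  have [F Fs] : exists F, F \in s.
    by case: s ss {sY sU fP} n1 => [<-//|F s] *; exists F; rewrite mem_head.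
  pose pos x := index (initial t l0 x) cl.
  pose g x := nth x (enum_fset F) (pos x).
  have gP x : x \in u -> g x \in F /\ t k (g x) = t k x.
    move=> xu; have [Gs xG] := fP _ xu.
    have [_ [lG clG]] := sY _ Gs; have [XF [lF clF]] := sY _ Fs.
    have xcl : initial t l0 x \in cl by rewrite -clG lG; apply: map_f.
    have px : pos x < size (enum_fset F).
      have <- : size cl = size (enum_fset F) by rewrite -clF size_map.
      by rewrite index_mem.
    split; first exact: mem_nth.
    have /initialP : initial t l0 (g x) = initial t l0 x; last by apply.
    rewrite -(nth_map x [::] (initial t l0) px).
    by have -> : map (initial t l0) F = cl; [rewrite -clF lF|exact: nth_index].
  case: (boolP (uniq (map g u))) => [ugu|].
    have [XF _] := sY _ Fs.
    have [|||_ [_ [/mapP[x xu ->] /mapP[y yu ->] gxy rg]]] := Xgood F XF k (map g u).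
    - by [].
    - by rewrite size_map.
    - by move=> _ /mapP[x /gP[gF _] ->].
    exists x, y; split=> //; first by apply: contra_neq gxy => ->.
    by rewrite -(r_inv k (g x) x (g y) y)//; [case: (gP _ xu)|case: (gP _ yu)].
  move=> nug; have [x [y [xu yu xy gxy]]] : exists x y,
      [/\ x \in u, y \in u, x != y & g x = g y].
    apply: contrapT => ng; move/negP: nug; apply.
    rewrite map_inj_in_uniq// => x y xu yu gxy; apply: contrapT => /eqP xy.
    by apply: ng; exists x, y.
  exists x, y; split=> //; rewrite -(r_inv k x x x y)//.
  have [_ <-] := gP _ xu; have [_ <-] := gP _ yu; by rewrite gxy.
- have : size s <= 1.
    rewrite -(undup_id us); have := @uniq_leq_size _ s [:: x] us; rewrite (undup_id us).
    by apply; move=> y /sx; rewrite !inE.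
  by rewrite ss ltnS leqn0 => /eqP n0; rewrite n0 in n1.
- exists I; split=> // k s us ss sI; apply: (gI s us ss sI k s us ss).
  by move=> x xs; rewrite inE.
Qed.

(** * Tree orders on the first uncountable ordinal *)

Lemma countable_enum (T : Type) (A : set T) (x0 : T) : countable A -> A x0 ->
  exists e : nat -> T, (forall j, A (e j)) /\ (forall x, A x -> exists j, e j = x).
Proof.
move=> /countable_injP[f f_inj] Ax0.
have /choice[e eP] : forall j, exists x, A x /\ forall y, A y -> f y = j -> x = y.
  move=> j; case: (pselect (exists x, A x /\ f x = j)) => [[x [Ax fx]]|nx].
    exists x; split=> // y Ay fy; apply: f_inj; rewrite ?fx//; exact: mem_set.
  by exists x0; split=> // y Ay fy; case: nx; exists y.
exists e; split=> [j|x Ax]; first by case: (eP j).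
by exists (f x); case: (eP (f x)) => _; apply.
Qed.

(** The order [lle] of omega_1 as the increasing union of tree orders of height
    at most omega, one for each level [k]: the predecessors of [x] in the tree
    order of level [k], ending with [x] itself, form the list [tpath k x]. *)
Record ladder (W : choiceType) := Ladder {
  lle : rel W;
  enum_below : W -> nat -> W;
  tpath : nat -> W -> seq W;
  lle_refl : reflexive lle;
  lle_trans : transitive lle;
  lle_total : total lle;
  lle_countable : forall x, countable [set y | lle y x];
  enum_belowP : forall x j, lle (enum_below x j) x;
  enum_below_surj : forall x y, lle y x -> exists j, enum_below x j = y;
  tpath_last : forall k x y, last y (tpath k x) = x;
  tpath_self : forall k x, x \in tpath k x;
  tpath_uniq : forall k x, uniq (tpath k x);
  tpath_prefix : forall k x, {in tpath k x, forall y, prefix (tpath k y) (tpath k x)};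
  tpath_mono : forall k x, {subset tpath k x <= tpath k.+1 x};
  tpath_eventually : forall x y, lle y x ->
    exists l, forall k, l <= k -> y \in tpath k x
}.

Section LadderExists.
Context (W : choiceType) (R : rel W).

Definition slt x y := (x != y) && R x y.

Lemma well_order_wf : wochoice.well_order R -> well_founded slt.
Proof.
move=> Rwo; have Ranti : antisymmetric R.
  have Rwc : wochoice.wo_chain R predT by move=> A _; apply: Rwo.
  have Rc := wochoice.wo_chain_antisymmetric Rwc.
  by move=> x y; apply: Rc.
move=> x; apply: contrapT => nx.
have [|z [[/asboolP nz zmin] _]] := Rwo (fun y => `[< ~ Acc slt y >]).
  by exists x; apply/asboolP.
apply: nz; constructor=> y /andP[yz Ryz]; apply: contrapT => ny.
have Rzy : R z y by apply: zmin; apply/asboolP.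
by move/eqP: yz; apply; apply: Ranti; rewrite Ryz.
Qed.

(** The path of [x] at level [k] continues the path of a point of the cofinal
    sequence [mx x] below [x]: of the first [k.+1] points of this sequence, the
    last one before the first failure of the sequence to follow paths of level
    [k].  As these failures disappear when [k] grows, every point below [x]
    enters the path of [x] in the end, and the paths increase with [k].  The
    recursion is on the well-founded order, hence the test of [slt y x]; the
    empty list is never used. *)
Definition path_step (mx : W -> nat -> W) x (rec : forall y, slt y x -> nat -> seq W) k :=
  let p y := if pselect (slt y x) is left h then rec y h k else [::] in
  if `[< exists y, slt y x >] then
    rcons (p (mx x (find (fun i => mx x i \notin p (mx x i.+1)) (iota 0 k)))) x
  else [:: x].

Lemma ladder_exists : wochoice.well_order R ->
  (forall x, countable [set y | R y x]) -> exists L : ladder W, lle L = R.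
Proof.
move=> Rwo Rc; have Rwc : wochoice.wo_chain R predT by move=> A _; apply: Rwo.
have Rrefl : reflexive R.
  by move=> x; apply: (wochoice.wo_chain_reflexive Rwc).
have Ranti : antisymmetric R.
  have h := wochoice.wo_chain_antisymmetric Rwc.
  by move=> x y; apply: h.
have Rtotal : total R.
  by move=> x y; apply: (wochoice.wo_chainW Rwc).
have Rtrans : transitive R.
  move=> y x z Rxy Ryz.
  have [|m [[+ mmin] _]] := Rwo [mem [:: x; y; z]].
    by exists x; apply: mem_head.
  move=> /or3P[/eqP mx|/eqP my|/orP[/eqP mz|//]].
  - by rewrite -mx; apply: mmin; rewrite !inE eqxx !orbT.
  - have Ryx : R y x by rewrite -{1}my; apply: mmin; rewrite !inE eqxx.
    by have -> : x = y by apply: Ranti; rewrite Rxy Ryx.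
  - have Rzx : R z x by rewrite -{1}mz; apply: mmin; rewrite !inE eqxx.
    have Rzy : R z y by rewrite -{1}mz; apply: mmin; rewrite !inE eqxx orbT.
    by have <- : y = z by apply: Ranti; rewrite Ryz Rzy.
have wf := well_order_wf Rwo.
have /choice[en enP] : forall x, exists e : nat -> W,
    (forall j, R (e j) x) /\ (forall y, R y x -> exists j, e j = y).
  by move=> x; have := @countable_enum _ [set y | R y x] x (Rc x) (Rrefl x).
have /choice[es esP] : forall x, exists e : nat -> W, (exists y, slt y x) ->
    (forall j, slt (e j) x) /\ (forall y, slt y x -> exists j, e j = y).
  move=> x; case: (pselect (exists y, slt y x)) => [[y yx]|nx]; last first.
    by exists (fun=> x) => /nx.
  have cs : countable [set y | slt y x].
    by apply: sub_countable (Rc x); apply: subset_card_le => z /andP[].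
  by have [e eP] := countable_enum cs yx; exists e.
(* a nondecreasing cofinal sequence below x: the running maxima of es x *)
pose mx x := fix m j := if j is i.+1 then
  (if R (m i) (es x i.+1) then es x i.+1 else m i) else es x 0.
have mx_slt x j : (exists y, slt y x) -> slt (mx x j) x.
  move=> ex; have [h _] := esP _ ex; elim: j => [|j IHj]; first exact: h.
  by rewrite [mx x j.+1]/=; case: ifP => _; [apply: h|apply: IHj].
have mx_mono x i j : i <= j -> R (mx x i) (mx x j).
  elim: j => [|j IHj]; first by rewrite leqn0 => /eqP ->.
  rewrite leq_eqVlt => /predU1P[->//|/IHj Rij] /=.
  by case: ifP => // Rj; apply: Rtrans Rj.
have mx_cof x y : slt y x -> exists j, R y (mx x j).
  move=> yx; have [_ /(_ _ yx)[j <-]] := esP x (ex_intro _ y yx); exists j.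
  case: j => [|j] //=; case: ifP => // nR.
  by have := Rtotal (mx x j) (es x j.+1); rewrite nR.
pose path0 := Fix wf (fun=> nat -> seq W) (path_step mx).
pose pa k x := path0 x k.
pose jj k x := find (fun i => mx x i \notin pa k (mx x i.+1)) (iota 0 k).
have paE k x : pa k x = if `[< exists y, slt y x >] then
    rcons (pa k (mx x (jj k x))) x else [:: x].
  rewrite /pa /path0 Fix_eq; last first.
    move=> y f g fg; congr path_step.
    by apply: functional_extensionality_dep => z; apply: functional_extensionality_dep => h.
  rewrite -/path0 /path_step; case: asboolP => // ex.
  have pE y : slt y x -> (if pselect (slt y x) is left h then path0 y k else [::]) = pa k y.
    by case: pselect.
  have -> : find (fun i => mx x i \notin
      (if pselect (slt (mx x i.+1) x) is left h then path0 (mx x i.+1) k else [::]))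
      (iota 0 k) = jj k x.
    by apply: eq_find => i /=; rewrite pE//; exact: (mx_slt x i.+1 ex).
  by rewrite pE//; exact: mx_slt.
have jj_le k x : jj k x <= k.
  by apply: leq_trans (find_size _ _) _; rewrite size_iota.
have jjP k x i : i < jj k x -> mx x i \in pa k (mx x i.+1).
  move=> ij; have ik := leq_trans ij (jj_le k x).
  by have := before_find 0 ij; rewrite nth_iota// add0n => /negbFE.
have jj_max k x j : j <= k -> (forall i, i < j -> mx x i \in pa k (mx x i.+1)) ->
    j <= jj k x.
  move=> jk jP; rewrite leqNgt; apply/negP => jjj.
  have jjk : jj k x < k := leq_trans jjj jk.
  have : has (fun i => mx x i \notin pa k (mx x i.+1)) (iota 0 k).
    by rewrite has_find size_iota.
  by move=> /(nth_find 0); rewrite nth_iota// add0n => /negP; apply; apply: jP.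
have pa_last k x y : last y (pa k x) = x.
  by rewrite paE; case: asboolP => //= _; rewrite last_rcons.
have pa_mem k x : x \in pa k x.
  by rewrite paE; case: asboolP => //= _; rewrite ?mem_rcons ?mem_head.
have pa_lle k x : {in pa k x, forall y, R y x}.
  elim/(well_founded_ind wf): x => x IHx y; rewrite paE.
  case: asboolP => [ex|_]; last by rewrite inE => /eqP ->.
  have mxx := mx_slt x (jj k x) ex; have /andP[_ Rmx] := mxx.
  rewrite mem_rcons inE => /predU1P[->//|/(IHx _ mxx) Rym].
  exact: Rtrans Rym Rmx.
have pa_uniq k x : uniq (pa k x).
  elim/(well_founded_ind wf): x => x IHx; rewrite paE.
  case: asboolP => // ex; have mxx := mx_slt x (jj k x) ex; have /andP[/eqP mxn Rmx] := mxx.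
  rewrite rcons_uniq IHx// andbT; apply/negP => /pa_lle Rxm; apply: mxn.
  by apply: Ranti; rewrite Rmx.
have pa_prefix k x : {in pa k x, forall y, prefix (pa k y) (pa k x)}.
  elim/(well_founded_ind wf): x => x IHx y; rewrite [pa k x]paE.
  case: asboolP => [ex|nx].
    have mxx := mx_slt x (jj k x) ex.
    rewrite mem_rcons inE => /predU1P[->|yp].
      by rewrite [pa k x]paE; case: asboolP => // _; apply: prefix_refl.
    by apply: prefix_trans (IHx _ mxx _ yp) _; apply: prefix_rcons.
  by rewrite inE => /eqP ->; rewrite paE; case: asboolP => // _; apply: prefix_refl.
have pa_sub k x y : y \in pa k x -> {subset pa k y <= pa k x}.
  by move=> /pa_prefix/prefixP[s ->] z; rewrite mem_cat => ->.
have pa_chain k x i j : i <= j -> j <= jj k x -> mx x i \in pa k (mx x j).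
  elim: j => [|j IHj]; first by rewrite leqn0 => /eqP ->.
  rewrite leq_eqVlt => /predU1P[->//|ij] jj'.
  apply: (pa_sub _ _ _ (jjP _ _ _ jj')); apply: IHj => //; exact: ltnW.
have pa_mono k x : {subset pa k x <= pa k.+1 x}.
  elim/(well_founded_ind wf): x => x IHx y.
  rewrite [pa k x]paE [pa k.+1 x]paE; case: asboolP => // ex.
  rewrite !mem_rcons !inE => /predU1P[->|yp]; first by rewrite eqxx.
  have jj1 : jj k x <= jj k.+1 x.
    apply: jj_max => [|i ij]; first exact: leq_trans (jj_le k x) _.
    by apply: IHx; [exact: mx_slt|exact: jjP].
  apply/orP; right; apply: (pa_sub _ _ (mx x (jj k x))); first exact: pa_chain.
  by apply: IHx => //; exact: mx_slt.
have pa_monol k l x : k <= l -> {subset pa k x <= pa l x}.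
  move=> kl; rewrite -(subnKC kl); elim: (l - k) => [|m IHm]; first by rewrite addn0.
  by move=> y /IHm; rewrite addnS; apply: pa_mono.
have pa_ev x y : R y x -> exists l, forall k, l <= k -> y \in pa k x.
  elim/(well_founded_ind wf): x y => x IHx y Ryx.
  case: (eqVneq y x) => [->|yx]; first by exists 0.
  have yltx : slt y x by rewrite /slt yx.
  have [j Rj] := mx_cof _ _ yltx.
  have ex : exists y, slt y x by exists y.
  have [l1 l1P] := IHx _ (mx_slt x j ex) y Rj.
  have [l2 l2P] : exists l, forall k, l <= k ->
      {in iota 0 j, forall i, mx x i \in pa k (mx x i.+1)}.
    apply: (@eventually_all _ _ (fun i k => mx x i \in pa k (mx x i.+1))) => i _.
    by apply: IHx; [exact: mx_slt|exact: mx_mono].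
  exists (maxn l1 (maxn l2 j)) => k; rewrite !geq_max => /and3P[l1k l2k jk].
  rewrite paE; case: asboolP => // _; rewrite mem_rcons inE; apply/orP; right.
  apply: (pa_sub _ _ (mx x j)); last exact: l1P.
  apply: pa_chain => //; apply: jj_max => // i ij.
  by apply: (l2P k l2k); rewrite mem_iota.
by exists (@Ladder W R en pa Rrefl Rtrans Rtotal Rc
  (fun x j => (enP x).1 j) (fun x y h => (enP x).2 y h)
  (fun k x y => pa_last k x y) pa_mem pa_uniq pa_prefix pa_mono pa_ev).
Qed.

End LadderExists.

Section LadderTheory.
Context (W : choiceType) (L : ladder W).
Local Notation path := (tpath L).

Lemma lle_uncountable (I : set W) (s : seq W) : ~ countable I ->
  exists2 x, I x & {in s, forall y, lle L y x}.
Proof.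
move=> ucI; have cB : countable (\bigcup_(y in [set` s]) [set z | lle L z y]).
  apply: bigcup_countable => [|y _]; last exact: lle_countable.
  by apply: finite_set_countable; apply: finite_seq.
have [x [Ix nx]] := uncountable_ex (uncountableD ucI cB); exists x => // y ys.
have /orP[//|xy] := lle_total L y x.
by case: nx; exists y.
Qed.

Lemma tpath_size k x : 0 < size (path k x).
Proof. by have := tpath_self L k x; case: (path k x). Qed.

Lemma tpath_sub k x y : y \in path k x -> {subset path k y <= path k x}.
Proof. by move=> /tpath_prefix/prefixP[s ->] z; rewrite mem_cat => ->. Qed.

Lemma tpath_monol k l x : k <= l -> {subset path k x <= path l x}.
Proof.
move=> kl; rewrite -(subnKC kl); elim: (l - k) => [|m IHm].
  by rewrite addn0.
by move=> y /IHm; rewrite addnS; apply: tpath_mono.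
Qed.

Lemma tpath_take k x y : y \in path k x ->
  path k y = take (size (path k y)) (path k x).
Proof. by move=> /tpath_prefix; rewrite prefixE => /eqP. Qed.

Lemma tpath_size_le k x y : y \in path k x -> size (path k y) <= size (path k x).
Proof. by move=> /tpath_prefix; apply: size_prefix. Qed.

Lemma tpath_nth k x y z : y \in path k x ->
  nth z (path k x) (size (path k y)).-1 = y.
Proof.
move=> yx; have s0 := tpath_size k y.
by rewrite -(nth_take z (n0 := size (path k y))) ?prednK// -tpath_take// nth_last tpath_last.
Qed.

Lemma tpath_comparable k x u v : u \in path k x -> v \in path k x ->
  size (path k u) <= size (path k v) -> u \in path k v.
Proof.
move=> ux vx uv; rewrite (tpath_take vx) -(tpath_nth u ux).
have s0 := tpath_size k u.
rewrite -(nth_take u (n0 := size (path k v))) ?prednK//; apply: mem_nth.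
by rewrite -tpath_take// prednK.
Qed.

Lemma tpath_size_inj k x u v : u \in path k x -> v \in path k x ->
  size (path k u) = size (path k v) -> u = v.
Proof. by move=> ux vx uv; rewrite -(tpath_nth u ux) uv tpath_nth. Qed.

Lemma tpath_nth_size k x z a : a < size (path k x) ->
  size (path k (nth z (path k x) a)) = a.+1.
Proof.
move=> ax; set y := nth _ _ _; have yx : y \in path k x by apply: mem_nth.
have s0 := tpath_size k y; have ys := tpath_size_le yx.
apply/eqP; rewrite -(prednK s0) eqSS -(nth_uniq z _ _ (tpath_uniq L k x)) ?prednK//.
by rewrite tpath_nth.
Qed.

Lemma tpath_eventually_all x (s : seq W) : {in s, forall y, lle L y x} ->
  exists l, forall k, l <= k -> {in s, forall y, y \in path k x}.
Proof.
move=> sx; apply: (@eventually_all _ _ (fun y k => y \in path k x)) => y ys.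
by apply: tpath_eventually; apply: sx.
Qed.

End LadderTheory.

(** * Bounded families of sequences *)

Lemma finite_values (V : choiceType) (U : eqType) (f : V -> U) (A : set V) m :
  (forall s, uniq s -> size s = m -> {in s, forall x, A x} ->
     exists x y, [/\ x \in s, y \in s, x != y & f x = f y]) ->
  exists vs : seq U, forall x, A x -> f x \in vs.
Proof.
move=> fA; apply: contrapT => nvs.
have [s [us ss sA finj]] : exists s : seq V, [/\ uniq s, size s = m,
    {in s, forall x, A x} & {in s &, injective f}].
  elim: m {fA} => [|m [s [us ss sA finj]]]; first by exists [::].
  have [x Ax xs] : exists2 x, A x & f x \notin map f s.
    apply: contrapT => nx; apply: nvs; exists (map f s) => x Ax.
    by apply: contrapT => /negP xs; apply: nx; exists x.
  have fx y : y \in s -> f x <> f y.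
    by move=> ys fxy; move/negP: xs; apply; rewrite fxy map_f.
  exists (x :: s); rewrite /= us ss; split=> //.
  - by rewrite andbT; apply: contraNN xs => /(map_f f).
  - by move=> y; rewrite inE => /predU1P[->//|/sA].
  - move=> y z; rewrite !inE => /predU1P[->|ys] /predU1P[->|zs] //.
    + by move/fx => /(_ zs).
    + by move/esym/fx => /(_ ys).
    + exact: finj.
have [x [y [xs ys /eqP xy fxy]]] := fA s us ss sA; apply: xy.
exact: finj.
Qed.

Lemma initialS (C V : Type) (t : nat -> V -> C) l x :
  initial t l.+1 x = rcons (initial t l x) (t l x).
Proof. by rewrite /initial -addn1 iotaD map_cat cats1. Qed.

(** Call two points unrelated at level [k] when their sequences first differ at
    [k].  This happens at one level at most, so there is an uncountable set in
    which no [n.+1] sequences first differ pairwise at the same level: their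
    initial segments form a tree in which every node has at most [n]
    successors, and such a tree has finite levels. *)
Lemma bounded_values n (W : choiceType) (z : nat -> W -> nat) (I0 : set W) :
  K_step n -> 1 < n -> ~ countable I0 ->
  exists (I : set W) (g : nat -> nat), [/\ I `<=` I0, ~ countable I &
    forall k x, I x -> z k x <= g k].
Proof.
move=> hK n1 ucI0.
pose r k (x y : W) := (initial z k x == initial z k y) ==> (z k x == z k y).
have [||||I [II0 ucI rI]] := @coherent_subset n W (seq nat)
    (fun k => initial z k.+1) r I0 hK n1.
- move=> k x x' y y' /= xx' yy'; rewrite /r.
  have /initialP zx := xx'; have /initialP zy := yy'.
  rewrite !(zx k) ?(zy k)//.
  have -> : initial z k x = initial z k x' by apply/initialP => i ik; apply: zx; apply: ltnW.
  by have -> : initial z k y = initial z k y' by apply/initialP => i ik; apply: zy; apply: ltnW.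
- by move=> k x; rewrite /r !eqxx.
- move=> x y; case: (pselect (exists m, z m x != z m y)) => [[m zm]|nm]; last first.
    exists 0 => k _; apply/implyP => _; apply: contrapT => /negP zk.
    by apply: nm; exists k.
  exists m.+1 => k mk; apply/implyP => /eqP/initialP /(_ m mk) zxy.
  by rewrite zxy eqxx in zm.
- exact: ucI0.
have fin k : exists ps : seq (seq nat), forall x, I x -> initial z k x \in ps.
  elim: k => [|k [ps IHps]]; first by exists [:: [::]].
  have /choice[vs vsP] : forall p : seq nat, exists vs : seq nat, forall x,
      (I `&` [set x | initial z k x = p]) x -> z k x \in vs.
    move=> p; apply: (@finite_values _ _ _ _ n.+1) => s us ss sI.
    have [|x [y [xs ys xy /implyP rxy]]] := rI k s us ss; first by move=> x /sI[].
    exists x, y; split=> //; apply/eqP; apply: rxy; apply/eqP.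
    by have [_ ->] := sI _ xs; have [_ ->] := sI _ ys.
  exists [seq rcons p v | p <- ps, v <- vs p] => x Ix.
  rewrite initialS; apply: allpairs_f_dep; first exact: IHps.
  by apply: vsP.
have /choice[g gP] : forall k, exists g, forall x, I x -> z k x <= g.
  move=> k; have [ps psP] := fin k.+1.
  exists (\max_(p <- ps) last 0 p) => x Ix.
  have xp := psP x Ix; apply: leq_trans (leq_bigmax_seq _ xp isT).
  by rewrite initialS last_rcons.
by exists I, g.
Qed.

(** * A single branch *)

Definition nested (T : eqType) (s t : seq T) := prefix s t || prefix t s.

Lemma nested_refl (T : eqType) (s : seq T) : nested s s.
Proof. by rewrite /nested prefix_refl. Qed.

Lemma nestedC (T : eqType) (s t : seq T) : nested s t = nested t s.
Proof. exact: orbC. Qed.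

Lemma prefix_nested (T : eqType) (s t u : seq T) :
  prefix s u -> prefix t u -> nested s t.
Proof.
rewrite /nested !prefixE => /eqP su /eqP tu.
have [st|ts] := leqP (size s) (size t); apply/orP; [left|right].
  by rewrite -{1}tu take_takel// su.
by rewrite -{1}su take_takel ?tu//; apply: ltnW.
Qed.

Lemma prefix_map (T U : eqType) (f : T -> U) s t :
  prefix s t -> prefix (map f s) (map f t).
Proof. by move=> /prefixP[u ->]; rewrite map_cat; apply: prefix_prefix. Qed.

Lemma nested_prefix (T : eqType) (s t : seq T) :
  nested s t -> size s <= size t -> prefix s t.
Proof.
move=> /orP[//|/[dup] ts /size_prefix ts' st]; move: ts.
rewrite !prefixE => /eqP ts; rewrite take_oversize// in ts.
  by rewrite ts take_size.
Qed.

Lemma increasing_enum (K : nat -> Prop) : (forall N, exists2 k, N <= k & K k) ->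
  exists kappa : nat -> nat, {homo kappa : i j / i < j} /\ forall j, K (kappa j).
Proof.
move=> Kinf; have /choice[f fP] : forall N, exists k, N <= k /\ K k.
  by move=> N; have [k] := Kinf N; exists k.
exists (fun j => iteri j (fun _ k => f k.+1) (f 0)); split.
  apply: (homo_ltn ltn_trans) => j.
  by rewrite /=; case: (fP (iteri j (fun _ k => f k.+1) (f 0)).+1).
by case=> [|j] /=; apply: (fP _).2.
Qed.

Section Signature.
Context (W : choiceType) (L : ladder W) (C : eqType) (d : nat -> W -> C).

Definition signature k x := map (d k) (tpath L k x).

Lemma signature_prefix k x y : y \in tpath L k x ->
  prefix (signature k y) (signature k x).
Proof. by move=> yx; apply: prefix_map; apply: tpath_prefix. Qed.

End Signature.

Lemma lle_uncountable_above (W : choiceType) (L : ladder W) (I : set W) x :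
  ~ countable I -> ~ countable (I `&` [set y | lle L x y]).
Proof.
move=> ucI; apply: uncountableS (uncountableD ucI (lle_countable L x)).
by move=> y [Iy /= nyx]; split=> //=; have /orP[//|] := lle_total L x y.
Qed.

(** The signature of a point of a path is a prefix of the signature of its end,
    so that any two points have nested signatures from some level on, and at
    each level there are at most [n] pairwise incomparable signatures of points
    of an uncountable set.  This width is lowered step by step.  If, at
    infinitely many levels, two incomparable signatures are no longer than the
    signature of some point [x], then one of them is incomparable to that of
    [x], hence to that of every later point with [x] on its path: the later
    points have smaller width.  Otherwise, for each [x], from some level on, two
    incomparable signatures are never both at most as long as that of [x]; when
    this level is the same for uncountably many [x], these points have
    comparable signatures, as the longer of two could serve as [x]. *)
Lemma single_branch n (W : choiceType) (L : ladder W) (C : countType)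
  (d : nat -> W -> C) (I0 : set W) : K_step n -> 1 < n -> ~ countable I0 ->
  exists (I : set W) (kappa : nat -> nat), [/\ I `<=` I0, ~ countable I,
    {homo kappa : i j / i < j} & forall j x y, I x -> I y ->
      nested (signature L d (kappa j) x) (signature L d (kappa j) y)].
Proof.
move=> hK n1 ucI0; pose sig := signature L d.
pose r k x y := nested (sig k x) (sig k y).
have [|||//|I1 [I10 ucI1 rI1]] := @coherent_subset n W (seq C) sig r I0 hK n1.
- by move=> k x x' y y'; rewrite /r => -> ->.
- by move=> k x; apply: nested_refl.
- move=> x y; have /orP[xy|yx] := lle_total L x y.
    have [l lP] := tpath_eventually xy; exists l => k /lP/(signature_prefix d) pxy.
    by rewrite /r /nested pxy.
  have [l lP] := tpath_eventually yx; exists l => k /lP/(signature_prefix d) pyx.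
  by rewrite /r /nested pyx orbT.
(* width at most w, at the levels of an infinite set K *)
pose narrow w (I : set W) (K : nat -> Prop) := [/\ I `<=` I0, ~ countable I,
  forall N, exists2 k, N <= k & K k & forall k s, K k -> uniq s -> size s = w.+1 ->
    {in s, forall x, I x} -> exists x y, [/\ x \in s, y \in s, x != y & r k x y]].
suff [I [K [II0 ucI Kinf KI]]] : exists I K, narrow 1 I K.
  have [kappa [kmono kK]] := increasing_enum Kinf.
  exists I, kappa; split=> // j x y Ix Iy.
  case: (eqVneq x y) => [->|xy]; first exact: nested_refl.
  have [|||x' [y' []]] := KI (kappa j) [:: x; y] (kK j).
  - by rewrite /= inE xy.
  - by [].
  - by move=> z; rewrite !inE => /orP[] /eqP ->.
  - rewrite !inE /r => /orP[] /eqP -> /orP[] /eqP ->; rewrite ?eqxx// => _.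
    by rewrite nestedC.
suff narrower : forall w I K, narrow w I K -> exists I K, narrow 1 I K.
  apply: (narrower n I1 (fun=> True)); split=> // [N|k s _]; first by exists N.
  exact: rI1.
elim=> [|w IHw] I K [II0 ucI Kinf KI].
  have [x Ix] := uncountable_ex ucI; have [k _ Kk] := Kinf 0.
  have [//|//||x1 [x2 []]] := KI k [:: x] Kk.
    by move=> y; rewrite inE => /eqP ->.
  by rewrite !inE => /eqP -> /eqP ->; rewrite eqxx.
pose low x k := K k /\ exists a b, [/\ I a, I b, ~~ r k a b,
  size (sig k a) <= size (sig k x) & size (sig k b) <= size (sig k x)].
case: (pselect (exists2 x, I x & forall N, exists2 k, N <= k & low x k)).
  move=> [x Ix lowinf].
  have /choice[a aP] : forall k, exists a, low x k -> I a /\ ~~ r k x a.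
    move=> k; case: (pselect (low x k)) => [[Kk [a [b [Ia Ib nab ax bx]]]]|nl].
      case: (boolP (r k x a)) => [xa|xa]; last by exists a.
      case: (boolP (r k x b)) => [xb|xb]; last by exists b.
      case/negP: nab; rewrite /r nestedC in xa; rewrite /r nestedC in xb.
      exact: prefix_nested (nested_prefix xa ax) (nested_prefix xb bx).
    by exists x => /nl.
  have /choice[m mP] : forall y, exists m, lle L x y ->
      forall k, m <= k -> low x k -> ~~ r k y (a k).
    move=> y; case: (boolP (lle L x y)) => [xy|_]; last by exists 0.
    have [l lP] := tpath_eventually xy; exists l => _ k /lP xyk /aP[_].
    apply: contraNN => /orP[ya|ay].
      rewrite /r /nested; apply/orP; left.
      exact: prefix_trans (signature_prefix d xyk) ya.
    exact: prefix_nested (signature_prefix d xyk) ay.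
  have [m0 ucJ] := uncountable_fiber m (@lle_uncountable_above _ L _ x ucI).
  set J := _ `&` _ in ucJ; pose K' k := m0 <= k /\ low x k.
  have JI y : J y -> I y by case=> -[].
  have nJ : narrow w J K'.
    split=> // [y /JI/II0//|N|k s [mk lk] us ss sJ].
      have [k] := lowinf (maxn m0 N); rewrite geq_max => /andP[mk Nk] lk.
      by exists k.
    have [Ia nxa] := aP _ lk; have sna y : y \in s -> ~~ r k y (a k).
      by move=> /sJ[[_ xy] my]; apply: mP => //; rewrite my.
    have [||||y [z [+ + yz ryz]]] := KI k (a k :: s); rewrite /= ?ss//.
    - by case: lk.
    - rewrite us andbT; apply/negP => /sna/negP; apply; exact: nested_refl.
    - by move=> y; rewrite inE => /predU1P[->//|/sJ/JI].
    rewrite !inE => /predU1P[ya|ys] /predU1P[za|zs].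
    - by rewrite ya za eqxx in yz.
    - by have /negP[] := sna _ zs; rewrite /r nestedC -ya.
    - by have /negP[] := sna _ ys; rewrite -za.
    - by exists y, z.
  exact: IHw nJ.
move=> nlow.
have /choice[m mP] : forall x, exists m, I x -> forall k, m <= k -> ~ low x k.
  move=> x; apply: contrapT => nm; apply: nlow.
  have Ix : I x by apply: contrapT => nIx; apply: nm; exists 0.
  exists x => // N; apply: contrapT => nN; apply: nm; exists N => _ k Nk lk.
  by apply: nN; exists k.
have [m0 ucJ] := uncountable_fiber m ucI; set J := _ `&` _ in ucJ.
exists J, (fun k => m0 <= k /\ K k); split=> //.
- by move=> x [/II0].
- move=> N; have [k] := Kinf (maxn m0 N); rewrite geq_max => /andP[mk Nk] Kk.
  by exists k.
move=> k s [mk Kk] us ss sJ; case: s us ss sJ => [|x [|y [|? ?]]] //=.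
rewrite inE andbT => xy _ sJ.
have [Ix mx] : J x by apply: sJ; rewrite !inE eqxx.
have [Iy my] : J y by apply: sJ; rewrite !inE eqxx orbT.
exists x, y; split; rewrite ?inE ?eqxx ?orbT//; apply: contrapT => /negP nxy.
have [xy'|yx'] := leqP (size (sig k x)) (size (sig k y)).
  by apply: (mP y Iy k); [rewrite my|split=> //; exists x, y].
apply: (mP x Ix k); first by rewrite mx.
by split=> //; exists x, y; split=> //; apply: ltnW.
Qed.

(** * Sigma-n-linked families *)

Lemma uniq_map_inj_in (T U : eqType) (f : T -> U) (s : seq T) :
  uniq (map f s) -> {in s &, injective f}.
Proof.
elim: s => [|x s IHs] //= /andP[xs us] y z.
rewrite !inE => /predU1P[->|ys] /predU1P[->|zs] // fyz; last exact: IHs.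
- by case/negP: xs; rewrite fyz map_f.
- by case/negP: xs; rewrite -fyz map_f.
Qed.

Lemma initial_le (C : eqType) (V : Type) (t : nat -> V -> C) k l x y : k <= l ->
  initial t l x = initial t l y -> initial t k x = initial t k y.
Proof.
by move=> kl /initialP xy; apply/initialP => i ik; apply: xy; apply: leq_trans kl.
Qed.

Definition decode2 (i : nat) : nat * nat := odflt (0, 0) (unpickle i).

Lemma decode2K a b : decode2 (pickle (a, b)) = (a, b).
Proof. by rewrite /decode2 pickleK. Qed.

Definition masks N : seq bitseq := [seq tval t | t <- enum {: N.-tuple bool}].

Lemma mem_masks (m : bitseq) : m \in masks (size m).
Proof. by apply/mapP; exists (in_tuple m); rewrite ?mem_enum. Qed.

(** The index set [W * nat] in place of [W] gives each point [x] an enumeration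
    of all the indices that lie below it, in type omega. *)
Definition pair_below (W : choiceType) (L : ladder W) (x : W) i : W * nat :=
  (enum_below L x (decode2 i).1, (decode2 i).2).

Lemma pair_below_surj (W : choiceType) (L : ladder W) (x u : W) j : lle L u x ->
  exists i, pair_below L x i = (u, j).
Proof.
move=> /enum_below_surj[a au]; exists (pickle (a, j)).
by rewrite /pair_below decode2K au.
Qed.

Section Linked.
Context {d : Order.disp_t} {P : porderType d} {W : choiceType}.
Context (p : W -> nat -> P).

Definition bounded_pairs (s : seq (W * nat)) := bounded [seq p w.1 w.2 | w <- s].

Definition linked_coloring r (c : W -> nat -> nat) :=
  forall s, size s <= r -> {in s &, forall v w, c v.1 v.2 = c w.1 w.2} ->
    bounded_pairs s.

Lemma bounded_pairsS s1 s2 : {subset s1 <= s2} -> bounded_pairs s2 -> bounded_pairs s1.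
Proof. by move=> s12; apply: boundedS => _ /mapP[w /s12 ws ->]; apply: map_f. Qed.

End Linked.

Section LinkedStep.
Context (d : Order.disp_t) (P : porderType d) (W : choiceType) (L : ladder W).
Context (n r : nat) (p : W -> nat -> P) (c : W -> nat -> nat).

(** The sequence attached to [x].  The lengths of the paths separate any two
    points, as one of them is on the path of the other from some level on; the
    colors make points that agree up to [i.+1] have the same color at [i]. *)
Definition link_code k x : nat * nat :=
  (size (tpath L k x), c (pair_below L x k).1 (pair_below L x k).2).

Local Notation code := (initial link_code).

Lemma code_neq x y : x != y -> exists l, forall k, l <= k -> code k x <> code k y.
Proof.
wlog xy : x y / lle L x y => [wl nxy|nxy].
  have /orP[xy|yx] := lle_total L x y; first exact: wl.
  have [|l lP] := wl y x yx; first by rewrite eq_sym.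
  by exists l => k /lP yxk /esym.
have [l lP] := tpath_eventually xy; exists l.+1 => k lk /initialP /(_ l lk)[sxy _].
move/eqP: nxy; apply; apply: tpath_size_inj sxy; first exact: (lP l).
exact: tpath_self.
Qed.

Lemma code_separated (s : seq W) : exists l, forall k, l <= k ->
  {in s &, forall x y, x != y -> code k x <> code k y}.
Proof.
have [l lP] : exists l, forall k, l <= k ->
    {in s, forall x, {in s, forall y, x != y -> code k x <> code k y}}.
  apply: (@eventually_all _ _ (fun x k => {in s, forall y, x != y -> code k x <> code k y})).
  move=> x _; apply: (@eventually_all _ _ (fun y k => x != y -> code k x <> code k y)) => y _.
  case: (eqVneq x y) => [_|/code_neq[l lP]]; first by exists 0.
  by exists l => k /lP.
by exists l => k /lP lk x y xs ys; apply: lk.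
Qed.

(** The configuration in which the [r.+1] points of [G] will be bounded.  The
    points of [B] are padding, to have [n.+1] points in all.  As they are
    separated before level [l], where the points of [G] still agree, a map that
    respects codes up to [l] can only identify points of [G]. *)
Definition blocked i l (G B : seq W) := [/\ uniq (G ++ B), size G = r.+1,
  size B = n - r, {in G ++ B &, forall x y, code i.+1 x = code i.+1 y} &
  {in G &, forall x y, code l x = code l y} /\
  {in B, forall x, {in G ++ B, forall y, x != y -> code l x <> code l y}}].

Definition bounded_at i (G : seq W) := bounded_pairs p [seq pair_below L x i | x <- G].

Definition link_good (F : {fset W}) := forall i l G B, blocked i l G B ->
  {subset G ++ B <= F} -> bounded_at i G.

(** Amalgamate [n] conditions with the same codes up to a level [l0] at which
    the points of each condition are separated.  If [l0 <= i], the [n.+1]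
    points of the configuration agree up to [l0], so that they all have the
    same place in their conditions, and [n] conditions do not have room for
    them.  Otherwise, the configuration is copied into each of the conditions.
    The copy of [G] is bounded there: by goodness if it still has [r.+1]
    points, and by the coloring [c] if it has at most [r] points.  By K_n, the
    bounds in the [n] conditions have a lower bound, and each point of [G] is
    its own copy in the condition that it comes from. *)
Lemma link_amalgamation : property_K n P -> 0 < r < n -> linked_coloring p r c ->
  forall X : set {fset W}, ~ countable X -> (forall F, X F -> link_good F) ->
  exists Y : set {fset W}, [/\ Y `<=` X, ~ countable Y &
    forall (s : seq {fset W}) U, size s = n -> {in s, forall F, Y F} ->
      {in U, forall x, exists2 F, F \in s & x \in F} -> link_good U].
Proof.
move=> KP /andP[r0 rn] lc X ucX Xgood.
have [x0 _] : exists x0 : W, True.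
  apply: contrapT => nW; apply: ucX; apply: (@sub_countable _ _ _ [set fset0]) => //.
  apply: subset_card_le => F _ /=; apply/fsetP => x; case: nW; by exists x.
have /choice[lF lFP] : forall F : {fset W}, exists l, forall k, l <= k ->
    {in F &, forall x y, x != y -> code k x <> code k y}.
  by move=> F; apply: (code_separated (enum_fset F)).
pose type F := (lF F, [seq code (lF F) x | x <- enum_fset F]).
have [[l0 cl] ucY] := uncountable_fiber type ucX; set Y := _ `&` _ in ucY.
pose subs := [seq mask m (iota 0 (size cl)) | m <- masks (size cl)].
pose sel (F : {fset W}) s := [seq nth x0 (enum_fset F) a | a <- s].
have /choice[q qP] : forall e : nat * seq nat, exists q : {fset W} -> P,
    forall F, bounded_at e.1 (sel F e.2) ->
      {in sel F e.2, forall x, (q F <= p (pair_below L x e.1).1 (pair_below L x e.1).2)%O}.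
  move=> e; have /choice[q qP] : forall F, exists q, bounded_at e.1 (sel F e.2) ->
      {in sel F e.2, forall x, (q <= p (pair_below L x e.1).1 (pair_below L x e.1).2)%O}.
    move=> F; case: (pselect (bounded_at e.1 (sel F e.2))) => [[q qF]|nb].
      exists q => _ x xF; apply: qF; rewrite -map_comp; apply/mapP.
      by exists x.
    by exists (p x0 0) => /nb.
  by exists q.
(* only finitely many pairs of an index below l0 and a set of places occur *)
have [Z [ZY ucZ lZ]] := @property_K_families _ P n _ _ q Y
  [seq (i, s) | i <- iota 0 l0, s <- subs] KP ucY.
exists Z; split=> //; first by move=> F /ZY[].
move=> s U ss sZ sU i l G B [uGB sG sB ai [al sepB]] GBU.
have /choice[f fP] : forall x, exists F, x \in U -> F \in s /\ x \in F.
  move=> x; case: (boolP (x \in U)) => [/sU[F Fs xF]|_]; first by exists F.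
  by exists fset0.
pose pos x := index (code l0 x) cl; pose at_ (F : {fset W}) x := nth x0 (enum_fset F) (pos x).
have posP x F : x \in U -> F \in s ->
    [/\ pos x < size cl, at_ F x \in F & code l0 (at_ F x) = code l0 x].
  move=> xU Fs; have [Gs xG] := fP _ xU.
  have [_ [lG clG]] := ZY _ (sZ _ Gs); have [_ [lFF clF]] := ZY _ (sZ _ Fs).
  have xcl : code l0 x \in cl by rewrite -clG lG; apply: map_f.
  have szF : size cl = size (enum_fset F) by rewrite -clF size_map.
  have px : pos x < size (enum_fset F) by rewrite -szF index_mem.
  split; [by rewrite szF|exact: mem_nth|].
  rewrite -(nth_map x0 [::] (code l0) px).
  by have -> : map (code l0) F = cl; [rewrite -clF lFF|exact: nth_index].
have Fsep F : F \in s -> {in F &, forall x y, code l0 x = code l0 y -> x = y}.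
  move=> Fs x y xF yF xy; apply: contrapT => /eqP nxy.
  have [_ [lFF _]] := ZY _ (sZ _ Fs); apply: (lFP F l0 _ x y xF yF nxy xy).
  by rewrite lFF.
have fE x : x \in U -> at_ (f x) x = x.
  move=> xU; have [Fs xF] := fP _ xU; have [_ aF aE] := posP _ _ xU Fs.
  exact: (Fsep (f x)).
have GU x : x \in G -> x \in U by move=> xG; apply: GBU; rewrite mem_cat xG.
have BU x : x \in B -> x \in U by move=> xB; apply: GBU; rewrite mem_cat xB orbT.
have sGB : size (G ++ B) = n.+1 by rewrite size_cat sG sB addSn subnKC// ltnW.
(* the points have the same place in all conditions, the place of x1 *)
case: (leqP l0 i) => [li|il].
  have [x1 x1G] : exists x, x \in G by case: (G) sG => // x ?; exists x; apply: mem_head.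
  have : size (G ++ B) <= size [seq at_ F x1 | F <- s].
    apply: uniq_leq_size uGB _ => x xGB; have xU := GBU x xGB.
    have [Fs xF] := fP _ xU; have [_ aF aE] := posP _ _ (GU _ x1G) Fs.
    apply/mapP; exists (f x) => //; apply: (Fsep (f x)) => //.
    rewrite aE; apply: (initial_le (l := i.+1)); first exact: leqW.
    by apply: ai => //; rewrite mem_cat x1G.
  by rewrite size_map sGB ss ltnn.
pose as_ := [seq a <- iota 0 (size cl) | a \in map pos G].
have as_subs : as_ \in subs.
  apply/mapP; exists [seq a \in map pos G | a <- iota 0 (size cl)]; last exact: filter_mask.
  by rewrite -{2}(size_iota 0 (size cl)) -(size_map (fun a => a \in map pos G)) mem_masks.
have bF F : F \in s -> bounded_at i (sel F as_).
  move=> Fs; suff bG : bounded_at i (map (at_ F) G).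
    apply: bounded_pairsS bG => _ /mapP[_ /mapP[a + ->] ->].
    rewrite mem_filter => /andP[/mapP[x xG ->] _].
    by apply: map_f; apply/mapP; exists x.
  have zE x k : x \in U -> k < l0 -> link_code k (at_ F x) = link_code k x.
    by move=> xU kl; have [_ _ /initialP] := posP _ _ xU Fs; apply.
  have cE x k : x \in U -> k <= l0 -> code k (at_ F x) = code k x.
    by move=> xU kl; have [_ _ xF] := posP _ _ xU Fs; apply: initial_le xF.
  case: (boolP (uniq (map (at_ F) G))) => [uF|nuF].
    have ll : l <= l0.
      rewrite leqNgt; apply/negP => ll.
      case: (G) sG al uF GU => [|x1 [|x2 G']] //= [sG']; first by rewrite -sG' in r0.
      move=> al; rewrite inE negb_or -!andbA => /andP[/eqP nx _] GU; apply: nx.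
      congr nth; congr index; apply: initial_le (ltnW ll) _.
      by apply: al; rewrite !inE eqxx ?orbT.
    have Finj := uniq_map_inj_in uF.
    apply: (Xgood F _ i l _ (map (at_ F) B)); last first.
    - by rewrite -map_cat => _ /mapP[x /GBU xU ->]; have [] := posP _ _ xU Fs.
    - rewrite /blocked -map_cat !size_map sG sB; split=> //.
      + rewrite map_inj_in_uniq// => x y xGB yGB xy; apply: contrapT => /eqP nxy.
        have cxy : code l x = code l y.
          by rewrite -(cE x) ?GBU// xy cE ?GBU.
        move: (xGB) (yGB); rewrite !mem_cat => /orP[xG|xB] /orP[yG|yB].
        * by move/eqP: nxy; apply; apply: Finj.
        * by apply: (sepB y yB x xGB); rewrite // eq_sym.
        * exact: (sepB x xB y yGB nxy).
        * exact: (sepB x xB y yGB nxy).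
      + move=> _ _ /mapP[x xGB ->] /mapP[y yGB ->].
        by rewrite !cE ?GBU//; apply: ai.
      split; first by move=> _ _ /mapP[x xG ->] /mapP[y yG ->]; rewrite !cE ?GU//; apply: al.
      move=> _ /mapP[x xB ->] _ /mapP[y yGB ->] nxy.
      have [xU yU] := (BU _ xB, GBU _ yGB); rewrite !cE//.
      by apply: sepB => //; apply: contra_neq nxy => ->.
    - by have [] := ZY _ (sZ _ Fs).
  have su : size (undup (map (at_ F) G)) <= r.
    by rewrite -ltnS -sG -(size_map (at_ F)) ltn_size_undup.
  have lb : bounded_pairs p [seq pair_below L x i | x <- undup (map (at_ F) G)].
    apply: lc; first by rewrite size_map.
    move=> v w /mapP[x xm vE] /mapP[y ym wE]; move: xm ym; rewrite !mem_undup.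
    move=> /mapP[x' xG xE] /mapP[y' yG yE].
    have : link_code i (at_ F x') = link_code i (at_ F y').
      have xGB : x' \in G ++ B by rewrite mem_cat xG.
      have yGB : y' \in G ++ B by rewrite mem_cat yG.
      have /initialP xyE := ai _ _ xGB yGB; rewrite !zE ?GU//; exact: xyE.
    by rewrite vE wE xE yE => -[].
  by apply: bounded_pairsS lb => _ /mapP[x xG ->]; apply: map_f; rewrite mem_undup.
have [||Q QP] := lZ (i, as_) s _ _ sZ.
- by apply: allpairs_f; rewrite ?mem_iota.
- by rewrite ss.
exists Q => _ /mapP[_ /mapP[x xG ->] ->].
have xU := GU _ xG; have [Fs xF] := fP _ xU; have [px _ _] := posP _ _ xU Fs.
apply: Order.POrderTheory.le_trans (QP _ (map_f _ Fs)) _; apply: (qP (i, as_) (f x) (bF _ Fs)).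
rewrite -{1}(fE x xU); apply: map_f.
by rewrite mem_filter mem_iota add0n px map_f.
Qed.

(** An index is represented as a pair below a point of the uncountable set
    given by the amalgamation, together with padding from this set; its new
    color tells the place of the index, a level that separates the padding, and
    the code up to this level.  The representatives of [r.+1] indices of the
    same color form a good configuration with the padding of one of them.
    Points of the set whose code at some level is shared by only countably many
    others are dropped, so that there is padding. *)
Lemma linked_coloring_step : K_step n -> property_K n P ->
  ~ countable [set: W] -> 0 < r < n -> linked_coloring p r c ->
  exists c', linked_coloring p r.+1 c'.
Proof.
move=> hK KP ucW rn lc; have /andP[r0 rn'] := rn.
have n1 : 1 < n by apply: leq_ltn_trans rn'.
have [F G /fsubsetP GF gF i l G' B bl GB||||I [_ ucI gI]] :=
  @amalgamation n W link_good [set: W] hK.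
- by apply: gF bl _ => x /GB/GF.
- exact: link_amalgamation.
- move=> x _ i l G B [uGB sG sB _ _] GBx.
  have : size (G ++ B) <= size [:: x].
    by apply: uniq_leq_size => // y /GBx; rewrite !inE.
  by rewrite size_cat sG sB addSn subnKC ?(ltnW rn')//= ltnS leqNgt (ltnW n1).
- exact: ucW.
pose class l t := I `&` [set x | code l x = t].
pose I' := I `\` \bigcup_(lt in [set lt : nat * seq (nat * nat) |
  countable (class lt.1 lt.2)]) class lt.1 lt.2.
have ucI' : ~ countable I'.
  by apply: uncountableD => //; apply: bigcup_countable.
have ucclass x l : I' x -> ~ countable (class l (code l x)).
  by move=> [Ix nx] cl; apply: nx; exists (l, code l x).
have /choice[D DP] : forall w : W * nat, exists D : W * nat * nat * seq W,
    let: (x, i, l, B) := D in [/\ I x, pair_below L x i = w, i < l,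
      uniq (x :: B) & size B = n - r] /\
      [/\ {in B, forall y, I y /\ code i.+1 y = code i.+1 x} &
      {in x :: B &, forall y z, y != z -> code l y <> code l z}].
  move=> [u j]; have [x I'x ux] := lle_uncountable L [:: u] ucI'.
  have [i iE] := pair_below_surj j (ux _ (mem_head _ _)).
  have [B [uB sB BI xB]] := uncountable_seq [:: x] (n - r) (ucclass x i.+1 I'x).
  have [l lP] := code_separated (x :: B).
  exists (x, i, maxn i.+1 l, B); split; split=> //.
  - by case: I'x.
  - by rewrite leq_max leqnn.
  - by rewrite /= uB andbT; apply/negP => /xB; rewrite inE eqxx.
  - by apply: lP; rewrite leq_max leqnn orbT.
pose key (w : W * nat) := let: (x, i, l, _) := D w in (i, l, code l x).
exists (fun u j => pickle (key (u, j))) => s sr sc.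
have {sc} keyE : {in s &, forall v w, key v = key w}.
  move=> v w vs ws; have := sc v w vs ws; rewrite -!surjective_pairing.
  exact: (pcan_inj (@pickleK _)).
case: s sr keyE => [|w0 s0]; first by move=> _ _; apply: lc.
set s := w0 :: s0 => sr keyE; have w0s : w0 \in s by apply: mem_head.
case Dw0 : (D w0) (DP w0) => [[[x0 i] l] B] [[Ix0 x0E il uB sB] [BI sepB]].
pose pt w := (D w).1.1.1.
have ptP w : w \in s -> [/\ I (pt w), pair_below L (pt w) i = w & code l (pt w) = code l x0].
  move=> ws; have := keyE _ _ ws w0s; rewrite /key /pt Dw0.
  by case: (D w) (DP w) => [[[x i'] l'] B'] [[Ix xE _ _ _] _] [<- <- <-].
have link_i w : w \in s -> link_code i (pt w) = link_code i x0.
  by move=> ws; have [_ _ /initialP] := ptP w ws; apply.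
have cE : {in s &, forall v w, c v.1 v.2 = c w.1 w.2}.
  move=> v w vs ws; have [_ {2 3}<- _] := ptP v vs; have [_ {2 3}<- _] := ptP w ws.
  by have := link_i v vs; have := link_i w ws; rewrite /link_code => -[_ ->] [_ ->].
suff bs : bounded_pairs p (undup s).
  by apply: bounded_pairsS bs => w; rewrite mem_undup.
case: (leqP (size (undup s)) r) => [sr'|rs].
  by apply: lc => // v w; rewrite !mem_undup; apply: cE.
have {}rs : size (undup s) = r.+1.
  by apply/eqP; rewrite eqn_leq rs andbT (leq_trans (size_undup s)).
have pt_inj : {in s &, injective pt}.
  move=> v w vs ws vw; have [_ <- _] := ptP v vs; have [_ <- _] := ptP w ws.
  by rewrite vw.
pose G := map pt (undup s).
have GP x : x \in G -> I x /\ code l x = code l x0.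
  by move=> /mapP[w + ->]; rewrite mem_undup => /ptP[].
have GBs : size (G ++ B) = n.+1.
  by rewrite size_cat size_map rs sB addSn subnKC// ltnW.
have NGB x y : x \in B -> y \in G -> code l x <> code l y.
  move=> xB yG; have [_ ->] := GP _ yG; apply: (sepB x x0).
  - by rewrite inE xB orbT.
  - exact: mem_head.
  - by move: uB => /= /andP[/negP x0B _]; apply/eqP => xx0; rewrite -xx0 in x0B.
have uGB : uniq (G ++ B).
  have uG : uniq G.
    rewrite map_inj_in_uniq ?undup_uniq// => v w.
    by rewrite !mem_undup; apply: pt_inj.
  move: uB => /= /andP[_ uB]; rewrite cat_uniq uG uB andbT /=.
  apply/hasPn => x xB; apply/negP => xG.
  exact: (NGB x x).
have GBI : {in G ++ B, forall x, I x}.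
  by move=> x; rewrite mem_cat => /orP[/GP[]|/BI[]].
have ci x : x \in G ++ B -> code i.+1 x = code i.+1 x0.
  by rewrite mem_cat => /orP[/GP[_]|/BI[]//]; apply: initial_le.
have [||] := gI (G ++ B) uGB GBs GBI i l G B.
- split=> //; [by rewrite size_map|by move=> x y /ci -> /ci ->|split].
    by move=> x y /GP[_ ->] /GP[_ ->].
  move=> x xB y; rewrite mem_cat => /orP[yG _|yB xy]; first exact: NGB.
  by apply: sepB => //; rewrite inE ?xB ?yB orbT.
- by move=> x xGB; rewrite in_fset.
- move=> q qP; exists q => _ /mapP[w ws ->]; apply: qP; apply/mapP; exists w => //.
  apply/mapP; exists (pt w); first exact: map_f.
  by rewrite mem_undup in ws; have [_ ->] := ptP w ws.
Qed.

End LinkedStep.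

Lemma sigma_linked n (d : Order.disp_t) (P : porderType d) (W : choiceType)
  (L : ladder W) (p : W -> nat -> P) :
  K_step n -> 1 < n -> property_K n P -> ~ countable [set: W] ->
  exists c, linked_coloring p n c.
Proof.
move=> hK n1 KP ucW; suff h r : 0 < r <= n -> exists c, linked_coloring p r c.
  by apply: h; rewrite leqnn ltnW.
elim: r => [//|[|r] IHr] rn; last first.
  have [|c lc] := IHr; first by rewrite (ltnW (andP rn).2).
  exact: (@linked_coloring_step _ _ _ L n r.+1 _ _ hK KP ucW rn lc).
exists (fun _ _ => 0) => -[|w [|//]] _ _; last first.
  by exists (p w.1 w.2) => x; rewrite inE => /eqP ->.
have [x _] := uncountable_ex ucW; by exists (p x 0).
Qed.

(** * Pseudo-intersections *)

Lemma increasing_ge (kappa : nat -> nat) j :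
  {homo kappa : i j / i < j} -> j <= kappa j.
Proof.
by move=> kmono; elim: j => [//|j IHj]; apply: leq_ltn_trans IHj (kmono _ _ _).
Qed.

(** The part above [k] of the intersection of the sets attached to the path of
    [x] at level [k] decreases along paths, and has a finite nonempty piece
    when it is cut at a bound that works for uncountably many points.  On a
    single branch these pieces form a decreasing sequence of nonempty finite
    sets, and have a common point; the common points, one for each level, form
    the pseudo-intersection. *)
Lemma pseudo_intersection n (W : choiceType) (L : ladder W)
  (A : W -> W -> nat -> set nat) : K_step n -> 1 < n -> ~ countable [set: W] ->
  (forall (s : seq (W * W * nat)) N, exists2 b, N <= b &
     {in s, forall e, A e.1.1 e.1.2 e.2 b}) ->
  exists2 B : set nat, (forall N, exists2 b, N <= b & B b) &
    forall u v i, exists N, forall b, N <= b -> B b -> A u v i b.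
Proof.
move=> hK n1 ucW Ainf.
pose meets k x b := forall u v i, u \in tpath L k x -> v \in tpath L k x -> i <= k ->
  A u v i b.
have /choice[z zP] : forall kx : nat * W, exists b, kx.1 <= b /\ meets kx.1 kx.2 b.
  move=> [k x] /=; pose p := tpath L k x.
  have [b kb bA] := Ainf [seq (uv, i) | uv <- [seq (u, v) | u <- p, v <- p],
    i <- iota 0 k.+1] k.
  exists b; split=> // u v i up vp ik.
  apply: (bA (u, v, i)); apply: allpairs_f; last by rewrite mem_iota.
  exact: allpairs_f.
have [I1 [g [_ ucI1 gI1]]] := bounded_values (fun k x => z (k, x)) hK n1 ucW.
pose piece k x := [seq b <- index_iota k (g k).+1 | `[< meets k x b >]].
have piece_sub k x y : y \in tpath L k x -> {subset piece k x <= piece k y}.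
  move=> yx b; rewrite !mem_filter => /andP[/asboolP mb ->]; rewrite andbT.
  by apply/asboolP => u v i uy vy; apply: mb; apply: tpath_sub yx _ _.
have [I [kappa [II1 ucI kmono chain]]] := single_branch L piece hK n1 ucI1.
have /choice[h hP] : forall j, exists b, forall x, I x -> b \in piece (kappa j) x.
  move=> j; set k := kappa j; have [x1 Ix1] := uncountable_ex ucI.
  have ex : exists m, `[< exists2 x, I x & size (piece k x) = m >].
    by exists (size (piece k x1)); apply/asboolP; exists x1.
  case: (ex_minnP ex) => m /asboolP[x0 Ix0 xm] mmin.
  have : z (k, x0) \in piece k x0.
    have [kz mz] := zP (k, x0); rewrite mem_filter mem_index_iota kz /= ltnS.
    by apply/andP; split; [exact/asboolP|exact: gI1 (II1 _ Ix0)].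
  set b := z _ => bx0; exists b => x Ix.
  have sig_mem y : piece k y \in signature L piece k y.
    by apply: map_f; apply: tpath_self.
  case/orP: (chain j x x0 Ix Ix0) => /prefixP[t E].
    have : piece k x \in signature L piece k x0 by rewrite E mem_cat sig_mem.
    by move=> /mapP[y /piece_sub/(_ _ bx0) + ->].
  have : piece k x0 \in signature L piece k x by rewrite E mem_cat sig_mem.
  move=> /mapP[y /piece_sub yx yE].
  have ux : uniq (piece k x) by apply/filter_uniq/iota_uniq.
  have xx0 : {subset piece k x <= piece k x0} by rewrite yE.
  have mx : size (piece k x0) <= size (piece k x).
    by rewrite xm; apply: mmin; apply/asboolP; exists x.
  by have [_ ->] := uniq_min_size ux xx0 mx.
exists (range h) => [N|u v i].
  exists (h N); last by exists N.
  have [x Ix] := uncountable_ex ucI; have := hP N x Ix.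
  rewrite mem_filter mem_index_iota => /and3P[_ kh _].
  exact: leq_trans (increasing_ge N kmono) kh.
have [x Ix ux] := lle_uncountable L [:: u; v] ucI.
have [l lP] := tpath_eventually_all ux.
exists (\max_(j < maxn l i) h j).+1 => b hb [j _ jb]; rewrite -{b}jb in hb *.
have jl : maxn l i <= j.
  rewrite leqNgt; apply/negP => jl; move: hb; rewrite ltnNge.
  by rewrite (leq_bigmax (Ordinal jl)).
have := jl; rewrite geq_max => /andP[lj ij].
have jk := increasing_ge j kmono.
have := hP j x Ix; rewrite mem_filter => /andP[/asboolP mh _].
have lk := lP _ (leq_trans lj jk).
by apply: mh; [apply: lk|apply: lk|exact: leq_trans jk]; rewrite !inE eqxx ?orbT.
Qed.

(** * Sigma-centered families *)

Lemma exists_max_seq (T : eqType) (f : T -> nat) (s : seq T) : s != [::] ->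
  exists2 x, x \in s & {in s, forall y, f y <= f x}.
Proof.
elim: s => // x s IHs _; case: (eqVneq s [::]) => [->|/IHs[y ys ymax]].
  by exists x; rewrite ?mem_head// => y; rewrite inE => /eqP ->.
case: (leqP (f x) (f y)) => [xy|yx].
  exists y => [|z]; rewrite inE ?ys ?orbT// => /predU1P[->//|]; exact: ymax.
exists x => [|z]; rewrite ?mem_head// inE => /predU1P[->//|/ymax zy].
exact: leq_trans (ltnW yx).
Qed.

Lemma exists_lle_max (W : choiceType) (L : ladder W) (s : seq W) : s != [::] ->
  exists2 x, x \in s & {in s, forall y, lle L y x}.
Proof.
elim: s => // x s IHs _; case: (eqVneq s [::]) => [->|/IHs[y ys ymax]].
  by exists x; rewrite ?mem_head// => y; rewrite inE => /eqP ->; apply: lle_refl.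
have /orP[xy|yx] := lle_total L x y.
  exists y => [|z]; rewrite inE ?ys ?orbT// => /predU1P[->//|]; exact: ymax.
exists x => [|z]; rewrite ?mem_head// inE => /predU1P[->|/ymax zy].
  exact: lle_refl.
exact: lle_trans zy yx.
Qed.

Definition centered_coloring (d : Order.disp_t) (P : porderType d)
    (W : choiceType) (p : W -> nat -> P) (c : W -> nat -> nat) :=
  forall s, {in s &, forall v w, c v.1 v.2 = c w.1 w.2} -> bounded_pairs p s.

Definition lower_bounds_closed (d : Order.disp_t) (P : porderType d)
    (W : choiceType) (p : W -> nat -> P) :=
  forall s, bounded_pairs p s ->
    exists w : W * nat, {in s, forall v, (p w.1 w.2 <= p v.1 v.2)%O}.

Section Centered.
Context (d : Order.disp_t) (P : porderType d) (W : choiceType) (L : ladder W).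
Context (n : nat) (p : W -> nat -> P) (c : W -> nat -> nat) (g : nat -> nat).

Definition below_class e cc (E : seq W) := exists w : W * nat,
  c w.1 w.2 = cc /\
  {in [seq pair_below L x e | x <- E], forall v, (p w.1 w.2 <= p v.1 v.2)%O}.

Lemma below_classS e cc (E F : seq W) : {subset E <= F} ->
  below_class e cc F -> below_class e cc E.
Proof.
move=> EF [w [wc wF]]; exists w; split=> // v /mapP[x /EF xF ->].
by apply: wF; apply: map_f.
Qed.

(** A piece of information on [u] from a countable set, which is to decide the
    information at the lower levels ([h]), how the lower tree orders sit on the
    path of [u], and which parts of the path have lower bounds, in which of the
    classes up to [g k]. *)
Definition datum k (h : W -> seq nat) (u : W) :=
  (size (tpath L k u), h u,
   [seq [seq v \in tpath L i u | v <- tpath L k u] | i <- iota 0 k],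
   [seq [seq ([seq `[< below_class e cc (mask m (tpath L k u)) >] | cc <- iota 0 (g k).+1],
              `[< bounded_at L p e (mask m (tpath L k u)) >])
        | m <- masks (size (tpath L k u))] | e <- iota 0 k.+1]).

(** The signature at a level is a word in the types of that level; it becomes a
    number so that all types belong to one countable type. *)
Fixpoint history k : W -> seq nat :=
  if k is i.+1 then fun u =>
    rcons (history i u) (pickle (signature L (fun=> datum i (history i)) i u))
  else fun=> [::].

Definition type k u := datum k (history k) u.

Local Notation sig := (signature L type).
Local Notation path := (tpath L).

Lemma history_sig k u v : history k u = history k v ->
  forall i, i < k -> sig i u = sig i v.
Proof.
elim: k => // k IHk /= /rcons_inj[/IHk uv /(pcan_inj (@pickleK _)) suv] i.
by rewrite ltnS leq_eqVlt => /predU1P[->|/uv].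
Qed.

Lemma type_size k u v : type k u = type k v -> size (path k u) = size (path k v).
Proof. exact: (congr1 (fun t => t.1.1.1)). Qed.

Lemma type_sig k u v i : type k u = type k v -> i < k -> sig i u = sig i v.
Proof. by move=> /(congr1 (fun t => t.1.1.2))/history_sig uv; apply: uv. Qed.

Lemma type_order k u v i : type k u = type k v -> i < k ->
  [seq w \in path i u | w <- path k u] = [seq w \in path i v | w <- path k v].
Proof.
move=> /(congr1 (fun t => t.1.2))/eq_in_map uv ik.
by apply: (uv i); rewrite mem_iota.
Qed.

Lemma type_masks k u v e m : type k u = type k v -> e <= k ->
  size m = size (path k u) ->
  (forall cc, cc <= g k ->
    below_class e cc (mask m (path k u)) <-> below_class e cc (mask m (path k v))) /\
  (bounded_at L p e (mask m (path k u)) <-> bounded_at L p e (mask m (path k v))).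
Proof.
move=> uv ek mu; have uv' := type_size uv.
have /eq_in_map euv := congr1 (fun t => t.2) uv.
have := euv e; rewrite mem_iota add0n ltnS => /(_ ek).
rewrite -uv' => /eq_in_map /(_ m); rewrite -mu mem_masks => /(_ isT) {}euv.
split; last exact: asbool_eq_equiv (congr1 snd euv).
move=> cc ccg; have /eq_in_map /(_ cc) := congr1 fst euv.
rewrite mem_iota add0n ltnS => /(_ ccg) ccE; exact: asbool_eq_equiv ccE.
Qed.

Lemma sig_type k u v : sig k u = sig k v -> type k u = type k v.
Proof.
move=> /(congr1 (last (type k u))); rewrite /signature !last_map.
by rewrite !tpath_last.
Qed.

Lemma sig_size k u v : sig k u = sig k v -> size (path k u) = size (path k v).
Proof. by move=> /(congr1 size); rewrite !size_map. Qed.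

Lemma sig_take k x u : u \in path k x -> sig k u = take (size (path k u)) (sig k x).
Proof. by move=> ux; rewrite /signature -map_take -tpath_take. Qed.

Lemma sig_le k l u v : k <= l -> sig l u = sig l v -> sig k u = sig k v.
Proof.
rewrite leq_eqVlt => /predU1P[->//|kl] /sig_type uv.
exact: type_sig uv kl.
Qed.

Context (kappa : nat -> nat) (kappa_mono : {homo kappa : i j / i < j}).

Lemma kappa_le i j : i <= j -> kappa i <= kappa j.
Proof. by rewrite leq_eqVlt => /predU1P[->//|/kappa_mono/ltnW]. Qed.

(** Stated in terms of the signatures of [x] and [y] only: the longer path has
    a point at the place of the end of the shorter one, which is asked to be
    below the end of the longer path in the tree order of level [j] already.
    When both points are on one path, it says that they are comparable at
    level [j] ([alignedP]). *)
Definition aligned j x y :=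
  let place x y := nth false [seq w \in path (kappa j) y | w <- path (kappa j.+1) y]
    (size (path (kappa j.+1) x)).-1 in
  if size (path (kappa j.+1) x) <= size (path (kappa j.+1) y) then place x y
  else place y x.

Lemma aligned_sig j x x' y y' : sig (kappa j.+1) x = sig (kappa j.+1) x' ->
  sig (kappa j.+1) y = sig (kappa j.+1) y' -> aligned j x y = aligned j x' y'.
Proof.
move=> xx' yy'; rewrite /aligned (sig_size xx') (sig_size yy').
have kj : kappa j < kappa j.+1 by apply: kappa_mono.
by rewrite (type_order (sig_type xx') kj) (type_order (sig_type yy') kj).
Qed.

Lemma alignedP j x u v : u \in path (kappa j.+1) x -> v \in path (kappa j.+1) x ->
  aligned j u v = if size (path (kappa j.+1) u) <= size (path (kappa j.+1) v)
    then u \in path (kappa j) v else v \in path (kappa j) u.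
Proof.
move=> ux vx; have place a b : a \in path (kappa j.+1) x -> b \in path (kappa j.+1) x ->
    size (path (kappa j.+1) a) <= size (path (kappa j.+1) b) ->
    nth false [seq w \in path (kappa j) b | w <- path (kappa j.+1) b]
      (size (path (kappa j.+1) a)).-1 = (a \in path (kappa j) b).
  move=> ax bx ab; rewrite (nth_map a); last by rewrite prednK ?tpath_size.
  by rewrite tpath_nth//; exact: (tpath_comparable ax bx ab).
rewrite /aligned; case: leqP => [uv|vu]; first exact: place.
by apply: place => //; apply: ltnW.
Qed.

Context (I : set W).
Context (c_linked : linked_coloring p n c).
Context (I_chain : forall j x y, I x -> I y ->
  nested (sig (kappa j) x) (sig (kappa j) y)).
Context (I_aligned : forall j s, uniq s -> size s = n.+1 -> {in s, forall x, I x} ->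
  exists x y, [/\ x \in s, y \in s, x != y & aligned j x y]).
Context (I_class : forall k z e m, I z -> e <= k -> size m = size (path k z) ->
  bounded_at L p e (mask m (path k z)) ->
  exists2 cc, cc <= g k & below_class e cc (mask m (path k z))).
Context (m e : nat) (y0 : W) (em : e <= kappa m).

(** The points on the path of a point of [I] need not be in [I].  The inside
    points look like points of [I] at all levels from [m] to [i]; this is
    enough to have nested signatures. *)
Definition realized j y := exists2 z, I z & sig (kappa j) y = sig (kappa j) z.

Definition inside i y :=
  sig (kappa m) y = sig (kappa m) y0 /\ forall j, m <= j <= i -> realized j y.

Lemma inside_le i j y : j <= i -> inside i y -> inside j y.
Proof.
move=> ji [yt yr]; split=> // k /andP[mk kj]; apply: yr.
by rewrite mk (leq_trans kj).
Qed.

Lemma inside_sig i u v : m <= i -> sig (kappa i) u = sig (kappa i) v ->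
  inside i u -> inside i v.
Proof.
move=> mi uv [ut ur]; split; first by rewrite -ut; apply/esym/(sig_le (kappa_le mi)).
move=> j /[dup] mji /ur[z Iz uz]; exists z => //; rewrite -uz.
by apply/esym/(sig_le (kappa_le _) uv); case/andP: mji.
Qed.

Definition inner i x := [seq u <- path (kappa i) x | `[< inside i u >]].

Lemma inner_mem i x u : u \in inner i x <-> u \in path (kappa i) x /\ inside i u.
Proof.
rewrite mem_filter; split; first by move=> /andP[/asboolP].
by move=> [ux iu]; apply/andP; split=> //; apply/asboolP.
Qed.

Lemma inside_prefix i u v : m <= i -> inside i u -> inside i v ->
  size (path (kappa i) u) <= size (path (kappa i) v) ->
  sig (kappa i) u = take (size (path (kappa i) u)) (sig (kappa i) v).
Proof.
move=> mi [_ ur] [_ vr] uv.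
have [|y Iy uy] := ur i; first by rewrite mi leqnn.
have [|z Iz vz] := vr i; first by rewrite mi leqnn.
have := nested_prefix (I_chain i Iy Iz).
rewrite -uy -vz !size_map => /(_ uv); rewrite prefixE size_map => /eqP ->.
by [].
Qed.

(** The signatures of inside points are nested, so that points at the same
    place of their paths have the same signature, and are inside together. *)
Lemma inside_nth i u v z a : m <= i -> inside i u -> inside i v ->
  a < size (path (kappa i) u) -> size (path (kappa i) u) <= size (path (kappa i) v) ->
  sig (kappa i) (nth z (path (kappa i) u) a) = sig (kappa i) (nth z (path (kappa i) v) a).
Proof.
move=> mi iu iv au uv; have av := leq_trans au uv.
rewrite (sig_take (mem_nth z au)) (sig_take (mem_nth z av)) !tpath_nth_size//.
by rewrite (inside_prefix mi iu iv uv) take_takel.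
Qed.

(** At the lowest level the signature is given, and with it the length of the
    path: no two points of one path qualify. *)
Lemma inner_bounded_base x : inside m x -> bounded_at L p e (inner m x).
Proof.
move=> [xt _]; apply: (@bounded_pairsS _ _ _ _ _ [:: pair_below L x e]); last first.
  by exists (p (pair_below L x e).1 (pair_below L x e).2) => y; rewrite inE => /eqP ->.
move=> _ /mapP[u + ->]; rewrite mem_filter => /andP[/asboolP[ut _] ux].
suff -> : u = x by rewrite mem_head.
apply: tpath_size_inj ux (tpath_self _ _ _) _.
by apply: sig_size; rewrite ut xt.
Qed.

(** The inner part of the longest path looks like a part of the path of a point
    of [I], so that it has a lower bound in a class [cc] up to [g], and its
    type tells so.  The other inner parts look like initial parts of it, and
    their types tell that they have a lower bound in the same class. *)
Lemma inner_class i (M : seq W) : m <= i -> M != [::] ->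
  {in M, forall v, inside i v /\ bounded_at L p e (inner i v)} ->
  exists cc, {in M, forall v, below_class e cc (inner i v)}.
Proof.
move=> mi M0 MP; pose k := kappa i.
have ek : e <= k := leq_trans em (kappa_le mi).
have [v1 v1M v1max] := exists_max_seq (fun v => size (path k v)) M0.
have [iv1 bv1] := MP v1 v1M.
pose ms := [seq `[< inside i u >] | u <- path k v1].
have innerE : inner i v1 = mask ms (path k v1) by rewrite /inner filter_mask.
have sms : size ms = size (path k v1) by rewrite size_map.
have [|z Iz vz] := (iv1.2 i); first by rewrite mi leqnn.
have tz := sig_type vz.
have [cc ccg zcc] : exists2 cc, cc <= g k & below_class e cc (mask ms (path k z)).
  apply: I_class => //; first by rewrite sms (sig_size vz).
  by apply/(type_masks tz ek sms).2; rewrite -innerE.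
have vcc : below_class e cc (mask ms (path k v1)).
  by apply/((type_masks tz ek sms).1 cc ccg).
exists cc => v vM; have [iv _] := MP v vM.
have vv1 : size (path k v) <= size (path k v1) := v1max v vM.
have s0 := tpath_size L k v.
pose w := nth v (path k v1) (size (path k v)).-1.
have wv1 : w \in path k v1 by apply: mem_nth; rewrite prednK.
have sw : size (path k w) = size (path k v) by rewrite tpath_nth_size ?prednK.
have swv : sig k w = sig k v by rewrite (inside_prefix mi iv iv1 vv1) (sig_take wv1) sw.
pose mv := take (size (path k v)) ms.
have smv : size mv = size (path k w) by rewrite size_takel ?sms ?sw.
have : below_class e cc (mask mv (path k v)).
  apply/(((type_masks (sig_type swv) ek smv)).1 cc ccg); apply: below_classS vcc.
  have -> : mask ms (path k v1) = mask mv (take (size (path k v)) (path k v1)) ++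
      mask (drop (size (path k v)) ms) (drop (size (path k v)) (path k v1)).
    by rewrite -mask_cat ?cat_take_drop// !size_takel// sms.
  by rewrite (tpath_take wv1) sw => u um; rewrite mem_cat um.
apply: below_classS; rewrite /inner filter_mask.
suff -> : [seq `[< inside i u >] | u <- path (kappa i) v] = mv by [].
apply: (@eq_from_nth _ false).
  by rewrite size_map size_takel// sms.
move=> a; rewrite size_map => av; have av1 := leq_trans av vv1.
rewrite nth_take// (nth_map v)// (nth_map v)//.
have uE := inside_nth v mi iv iv1 av vv1.
by apply/asboolP/asboolP; apply: inside_sig => //; rewrite uE.
Qed.

(** The descent from level [i.+1] to level [i].  Among the inside points of a
    path, at most [n] are maximal in the tree order of level [i], as [n.+1] of
    them would look like [n.+1] points of [I], two of which are aligned.  The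
    inside points below each maximal one are bounded, by elements of the same
    class, and these at most [n] elements have a lower bound. *)
Lemma inner_bounded_step i x : m <= i ->
  (forall v, inside i v -> bounded_at L p e (inner i v)) ->
  inside i.+1 x -> bounded_at L p e (inner i.+1 x).
Proof.
move=> mi IHi ix; pose k := kappa i; pose E := inner i.+1 x.
have EP u : u \in E -> u \in path (kappa i.+1) x /\ inside i.+1 u by move/inner_mem.
pose M := [seq v <- E | all (fun w => (v \in path k w) ==> (w == v)) E].
have ME v : v \in M -> v \in E by rewrite mem_filter => /andP[].
have Mmax v w : v \in M -> w \in E -> v \in path k w -> w = v.
  by rewrite mem_filter => /andP[/allP h _] /h /implyP vw /vw /eqP.
have kk : k <= kappa i.+1 by apply: kappa_le.
(* every point of E is below a maximal one: climb while the path gets longer *)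
have Ebelow : {in E, forall u, exists2 v, v \in M & u \in path k v}.
  have h N u : u \in E -> size (path (kappa i.+1) x) - size (path k u) <= N ->
      exists2 v, v \in M & u \in path k v.
    elim: N u => [|N IHN] u uE uN.
      exists u; last exact: tpath_self.
      rewrite mem_filter uE andbT; apply/allP => w wE; apply/implyP => uw.
      have wx : size (path k w) <= size (path (kappa i.+1) x).
        apply: uniq_leq_size; first exact: tpath_uniq.
        move=> y /(tpath_monol kk); apply: tpath_sub; exact: (EP _ wE).1.
      apply/eqP/esym; apply: (tpath_size_inj uw (tpath_self _ _ _)); apply/eqP.
      rewrite eqn_leq (tpath_size_le uw)/=; apply: leq_trans wx _.
      by rewrite -subn_eq0 -leqn0.
    case: (boolP (u \in M)) => [uM|]; first by exists u => //; apply: tpath_self.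
    rewrite mem_filter uE andbT => /allPn[w wE]; rewrite negb_imply => /andP[uw wu].
    have lt : size (path k u) < size (path k w).
      rewrite ltn_neqAle (tpath_size_le uw) andbT; apply: contra_neq wu => suw.
      exact/esym/(tpath_size_inj uw (tpath_self _ _ _) suw).
    have [|v vM wv] := IHN w wE.
      rewrite -ltnS; apply: leq_trans uN.
      case: (leqP (size (path (kappa i.+1) x)) (size (path k u))).
        move=> xu; have wx : size (path k w) <= size (path (kappa i.+1) x).
          apply: uniq_leq_size; first exact: tpath_uniq.
          move=> y /(tpath_monol kk); apply: tpath_sub; exact: (EP _ wE).1.
        by have := leq_trans lt (leq_trans wx xu); rewrite ltnn.
      by move=> ux; apply: ltn_sub2l.
    by exists v => //; apply: tpath_sub wv _ uw.
  by move=> u uE; apply: h uE (leqnn _).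
have uM : uniq M by rewrite filter_uniq// filter_uniq// tpath_uniq.
have sM : size M <= n.
  rewrite leqNgt; apply/negP => nM; pose s := take n.+1 M.
  have sM v : v \in s -> v \in M by apply: mem_take.
  have /choice[Z ZP] : forall v, exists z, v \in M ->
      I z /\ sig (kappa i.+1) v = sig (kappa i.+1) z.
    move=> v; case: (boolP (v \in M)) => [/ME/EP[_ [_ vr]]|_]; last by exists v.
    by have [|z Iz vz] := vr i.+1; [rewrite leqnn (leqW mi)|exists z].
  have Zinj : {in s &, injective Z}.
    move=> v w /sM vM /sM wM vw; have [vx _] := EP v (ME v vM).
    have [wx _] := EP w (ME w wM); apply: (tpath_size_inj vx wx).
    have [_ vz] := ZP v vM; have [_ wz] := ZP w wM.
    by rewrite (sig_size vz) vw (sig_size wz).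
  have [|||y [z [/mapP[v vs ->] /mapP[w ws ->] yz]]] := @I_aligned i (map Z s).
  - by rewrite map_inj_in_uniq// take_uniq.
  - by rewrite size_map size_takel.
  - by move=> _ /mapP[v /sM/ZP[Iz _] ->].
  have [vM wM] := (sM v vs, sM w ws); have [[vx _] [wx _]] := (EP v (ME v vM), EP w (ME w wM)).
  have [_ vz] := ZP v vM; have [_ wz] := ZP w wM.
  rewrite -(aligned_sig vz wz) (alignedP vx wx).
  case: leqP => _ => [/(Mmax v w vM (ME w wM)) wv|/(Mmax w v wM (ME v vM)) wv];
    by rewrite wv eqxx in yz.
have M0 : M != [::].
  have [|v vM _] := Ebelow x; last by apply: contraTneq vM => ->.
  by apply/inner_mem; split=> //; apply: tpath_self.
have [v vM|cc ccP] := @inner_class i M mi M0.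
  have [_ iv] := EP v (ME v vM); have iv' := inside_le (leqnSn i) iv.
  by split=> //; apply: IHi.
have /choice[w wP] : forall v, exists w : W * nat, v \in M -> c w.1 w.2 = cc /\
    {in [seq pair_below L y e | y <- inner i v], forall u, (p w.1 w.2 <= p u.1 u.2)%O}.
  move=> v; case: (boolP (v \in M)) => [/ccP[w wP]|_]; first by exists w.
  by exists (x, 0).
have [||q qP] := c_linked (s := map w M).
- by rewrite size_map.
- by move=> _ _ /mapP[u /wP[uc _] ->] /mapP[v /wP[vc _] ->]; rewrite uc vc.
exists q => _ /mapP[_ /mapP[u uE ->] ->]; have [v vM uv] := Ebelow u uE.
have [_ iu] := EP u uE.
apply: Order.POrderTheory.le_trans (qP _ (map_f _ (map_f w vM))) _.
have [_ vP] := wP v vM; apply: vP; apply: map_f; apply/inner_mem; split=> //.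
exact: inside_le iu.
Qed.

Lemma inner_bounded i x : m <= i -> inside i x -> bounded_at L p e (inner i x).
Proof.
move=> mi; rewrite -(subnKC mi); elim: (i - m) x => [|j IHj] x.
  by rewrite addn0; apply: inner_bounded_base.
by rewrite addnS; apply: inner_bounded_step; first exact: leq_addr.
Qed.

End Centered.

(** The color of an index tells its place [e] below a point of the uncountable
    set [I] that represents it, and the signature of this point at level [e].
    The representatives of finitely many indices of one color are on the path
    of the largest of them at some level, and are inside points there: they are
    bounded by [inner_bounded]. *)
Lemma sigma_centered n (d : Order.disp_t) (P : porderType d) (W : choiceType)
  (L : ladder W) (p : W -> nat -> P) :
  K_step n -> 1 < n -> property_K n P -> ~ countable [set: W] ->
  lower_bounds_closed p -> exists c, centered_coloring p c.
Proof.
move=> hK n1 KP ucW plb; have [c c_linked] := sigma_linked L p hK n1 KP ucW.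
have /choice[cl clP] : forall eE : nat * seq W, exists cc,
    bounded_at L p eE.1 eE.2 -> below_class L p c eE.1 cc eE.2.
  move=> [e E] /=; case: (pselect (bounded_at L p e E)) => [/plb[w wE]|nb].
    by exists (c w.1 w.2) => _; exists w.
  by exists 0 => /nb.
(* the largest of the classes where the bounded parts of the path of x have
   lower bounds; g is a bound of it for uncountably many points *)
pose z k x := \max_(e <- iota 0 k.+1) \max_(m <- masks (size (tpath L k x)))
  cl (e, mask m (tpath L k x)).
have [I1 [g [_ ucI1 gI1]]] := bounded_values z hK n1 ucW.
have [I2 [kappa [I21 ucI2 kmono chain]]] :=
  single_branch L (type L p c g) hK n1 ucI1.
pose sig := signature L (type L p c g).
have [||||I [I2I ucI aI]] := @coherent_subset n W _ (fun j x => sig (kappa j.+1) x)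
    (fun j x y => aligned L kappa j x y) I2 hK n1.
- by move=> j x x' y y' xx' yy'; apply: (aligned_sig kmono xx' yy').
- move=> j x; rewrite (@alignedP _ _ kappa j x x x) ?tpath_self//.
  by rewrite leqnn.
- have far x y : lle L x y -> exists l, forall j, l <= j ->
      x \in tpath L (kappa j) y /\ x \in tpath L (kappa j.+1) y.
    move=> /tpath_eventually[l lP]; exists l => j lj.
    have lk := leq_trans lj (increasing_ge j kmono).
    by split; apply: lP => //; apply: leq_trans lk (ltnW (kmono _ _ _)).
  move=> x y; have /orP[/far[l lP]|/far[l lP]] := lle_total L x y; exists l => j /lP[h1 h2].
    by rewrite (alignedP h2 (tpath_self _ _ _)) (tpath_size_le h2).
  rewrite (alignedP (tpath_self _ _ _) h2); case: leqP => // xy.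
  suff -> : x = y by apply: tpath_self.
  apply: (tpath_size_inj (tpath_self _ _ _) h2); apply/eqP.
  by rewrite eqn_leq xy tpath_size_le.
- exact: ucI2.
have I_class k x e m : I x -> e <= k -> size m = size (tpath L k x) ->
    bounded_at L p e (mask m (tpath L k x)) ->
    exists2 cc, cc <= g k & below_class L p c e cc (mask m (tpath L k x)).
  move=> /I2I/I21 Ix ek sm /(clP (e, _)) /= bc.
  exists (cl (e, mask m (tpath L k x))) => //; apply: leq_trans (gI1 k x Ix).
  have ek' : e \in iota 0 k.+1 by rewrite mem_iota.
  have mm : m \in masks (size (tpath L k x)) by rewrite -sm mem_masks.
  apply: leq_trans (leq_bigmax_seq e ek' isT).
  by have := leq_bigmax_seq (F := fun m => cl (e, mask m (tpath L k x))) m mm isT.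
have I_chain j x y : I x -> I y -> nested (sig (kappa j) x) (sig (kappa j) y).
  by move=> /I2I Ix /I2I Iy; apply: chain.
have /choice[D DP] : forall w : W * nat, exists D : W * nat,
    I D.1 /\ pair_below L D.1 D.2 = w.
  move=> [u j]; have [x Ix ux] := lle_uncountable L [:: u] ucI.
  by have [e eE] := pair_below_surj j (ux u (mem_head _ _)); exists (x, e).
pose key w := ((D w).2, sig (kappa (D w).2) (D w).1).
exists (fun u j => pickle (key (u, j))) => s sc.
have {sc} keyE : {in s &, forall v w, key v = key w}.
  move=> v w vs ws; have := sc v w vs ws; rewrite -!surjective_pairing.
  exact: (pcan_inj (@pickleK _)).
case: (eqVneq s [::]) => [->|s0].
  by have [x _] := uncountable_ex ucW; exists (p x 0).
have [|x xs xmax] := exists_lle_max L (s := [seq (D w).1 | w <- s]).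
  by case: (s) s0.
have /mapP[w0 w0s xE] := xs; pose e := (D w0).2.
have ke : e <= kappa e by apply: increasing_ge.
have [l lP] := tpath_eventually_all xmax; pose i := maxn e l.
have ei : e <= i by rewrite leq_max leqnn.
have realD w : realized L p c g kappa I i (D w).1.
  by exists (D w).1 => //; have [] := DP w.
have insD w : w \in s -> inside L p c g kappa I e x i (D w).1.
  move=> ws; split=> [|j _]; last by exists (D w).1 => //; have [] := DP w.
  by have [de se] := keyE _ _ ws w0s; rewrite xE /e -[RHS]se de.
have := @inner_bounded _ P W L n p c g kappa kmono I c_linked I_chain aI I_class
  e e x ke i x ei.
have := insD _ w0s; rewrite -xE => /[swap]/[apply]; apply: bounded_pairsS => w ws.
have [Iw wE] := DP w; apply/mapP; exists (D w).1.
  apply/inner_mem; split; last exact: insD.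
  apply: lP; last exact: map_f.
  by apply: leq_trans (increasing_ge i kmono); rewrite leq_max leqnn orbT.
by have [de _] := keyE _ _ ws w0s; rewrite /e -de wE.
Qed.

(** * Generic centered sets *)

Lemma injective_unbounded (f : nat -> nat) N : injective f -> exists M, N <= f M.
Proof.
move=> finj; apply: contrapT => nf.
have [|||x [y [_ _ xy /finj xy']]] := @pigeonhole_seq _ _ f (iota 0 N.+1) (iota 0 N).
- exact: iota_uniq.
- by rewrite !size_iota.
- move=> M _; rewrite mem_iota add0n ltnNge; apply/negP => fM; apply: nf.
  by exists M.
by rewrite xy' eqxx in xy.
Qed.

Section Generic.
Context (d : Order.disp_t) (P : porderType d) (W : choiceType) (L : ladder W).
Context (p : W -> nat -> P) (c : W -> nat -> nat) (D : W * nat -> set P).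
Context (D_open : forall t q r, D t q -> (r <= q)%O -> D t r).
Context (D_dense : forall t (v : W * nat), exists2 w : W * nat,
  (p w.1 w.2 <= p v.1 v.2)%O & D t (p w.1 w.2)).

(** Coded so that every color has infinitely many codes: sets of codes can be
    infinite and have pseudo-intersections. *)
Let color l := (decode2 l).1.

Definition refinement b t (v w : W * nat) :=
  [/\ c w.1 w.2 = color b, (p w.1 w.2 <= p v.1 v.2)%O & D t (p w.1 w.2)].

Lemma common_refinement (s : seq ((W * nat) * (W * nat))) w0 N :
  {in s, forall e, (p w0.1 w0.2 <= p e.1.1 e.1.2)%O} ->
  exists2 b, N <= b & (exists w, c w.1 w.2 = color b) /\
    {in s, forall e, exists w, refinement b e.2 e.1 w}.
Proof.
move=> sw; have [w ww0 wD] : exists2 w : W * nat, (p w.1 w.2 <= p w0.1 w0.2)%O &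
    {in s, forall e, D e.2 (p w.1 w.2)}.
  elim: s {sw} => [|e s [w ww0 ws]]; first by exists w0.
  have [w' w'w w'e] := D_dense e.2 w.
  exists w'; first exact: Order.POrderTheory.le_trans w'w ww0.
  by move=> e'; rewrite inE => /predU1P[->//|/ws]; move/D_open; apply.
have colE M : color (pickle (c w.1 w.2, M)) = c w.1 w.2 by rewrite /color decode2K.
have [M NM] := @injective_unbounded (fun M => pickle (c w.1 w.2, M)) N
  (fun M M' e => congr1 snd (pcan_inj (@pickleK _) e)).
exists (pickle (c w.1 w.2, M)) => //; split; first by exists w; rewrite colE.
move=> e es; exists w; split; [by rewrite colE| |exact: wD].
by apply: Order.POrderTheory.le_trans ww0 _; apply: sw.
Qed.

Definition inhabited_color l := exists w, c w.1 w.2 = color l.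

(** Finitely many indices of the color of [l] have a lower bound, below which
    finitely many requirements can be met: so the sets of codes [b] for which
    [v] has a refinement meeting [t] have infinite finite intersections, and an
    infinite pseudo-intersection [B].  The second index coded in [a] turns
    these sets into a family indexed by two points and an integer. *)
Lemma successors n l : K_step n -> 1 < n -> ~ countable [set: W] ->
  centered_coloring p c -> lower_bounds_closed p -> exists B : set nat,
  [/\ forall N, exists2 b, N <= b & B b, B `<=` inhabited_color &
    forall v t, c v.1 v.2 = color l -> exists N, forall b, N <= b -> B b ->
      exists w, refinement b t v w].
Proof.
move=> hK n1 ucW cc plb.
pose A u y a := [set b | inhabited_color b /\ let ij := decode2 a in
  (c u ij.1 = color l -> exists w, refinement b (y, ij.2) (u, ij.1) w)].
have [s N|B Binf BA] := @pseudo_intersection n W L A hK n1 ucW.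
  pose s1 := [seq e <- s | c e.1.1 (decode2 e.2).1 == color l].
  pose f (e : W * W * nat) := ((e.1.1, (decode2 e.2).1), (e.1.2, (decode2 e.2).2)).
  have [w0 w0P] : exists w0 : W * nat, {in map f s1, forall e,
      (p w0.1 w0.2 <= p e.1.1 e.1.2)%O}.
    have [|w0 w0P] := plb [seq e.1 | e <- map f s1].
      apply: cc => _ _ /mapP[_ /mapP[e + ->] ->] /mapP[_ /mapP[e' + ->] ->].
      by rewrite !mem_filter => /andP[/eqP h _] /andP[/eqP h' _]; rewrite /= h h'.
    by exists w0 => e es; apply: w0P; apply: map_f.
  have [b Nb [bi bs]] := common_refinement N w0P.
  exists b => // e es; split=> //= ec; apply: (bs (f e)); apply: map_f.
  by rewrite mem_filter ec eqxx.
have [x _] := uncountable_ex ucW; have [N0 N0P] := BA x x 0.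
exists [set b | N0 <= b /\ B b]; split.
- move=> N; have [b] := Binf (maxn N N0); rewrite geq_max => /andP[Nb N0b] Bb.
  by exists b.
- by move=> b [N0b Bb]; have [] := N0P b N0b Bb.
move=> [u i] [y j] /= uc; have [N NP] := BA u y (pickle (i, j)); exists N => b Nb [_ Bb].
by have [_] := NP b Nb Bb; rewrite /= decode2K; apply.
Qed.

(** The argument of Bell.  For each requirement [t], a point [along t s] follows
    a finite sequence [s] of codes (the last code first): it starts with an
    arbitrary point of the color of the first code, and takes the refinements
    of [successors] at the next ones, provided that these are at least
    [bar t s].  One sequence [g] eventually dominates all the [bar t], so that
    an infinite sequence of codes can be chosen that is good for every [t] from
    some step [a t] on.  At each step, the points for all the [t] that have
    started have the same color, hence any finitely many have a lower bound. *)
Lemma generic n : K_step n -> 1 < n -> ~ countable [set: W] ->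
  centered_coloring p c -> lower_bounds_closed p -> exists2 G : set (W * nat),
  (forall s, {in s, forall v, G v} -> bounded_pairs p s) &
  forall t, exists2 v, G v & D t (p v.1 v.2).
Proof.
move=> hK n1 ucW cc plb.
have /choice[B BP] := fun l => successors l hK n1 ucW cc plb.
have /choice[N NP] : forall e : nat * (W * nat) * (W * nat), exists N,
    c e.1.2.1 e.1.2.2 = color e.1.1 ->
    forall b, N <= b -> B e.1.1 b -> exists w, refinement b e.2 e.1.2 w.
  move=> [[l v] t] /=; have [_ _ lB] := BP l.
  by case: (pselect (c v.1 v.2 = color l)) => [/lB|h]; [move=> /(_ t)[N NP]|];
    [exists N|exists 0].
have /choice[ref refP] : forall e : nat * (W * nat) * (W * nat), exists w,
    (exists w, refinement e.1.1 e.2 e.1.2 w) -> refinement e.1.1 e.2 e.1.2 w.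
  move=> e; case: (pselect (exists w, refinement e.1.1 e.2 e.1.2 w)) => [[w h]|h].
    by exists w.
  by exists e.2.
have [x0 _] := uncountable_ex ucW.
have /choice[start startP] : forall l, exists w : W * nat,
    inhabited_color l -> c w.1 w.2 = color l.
  move=> l; case: (pselect (inhabited_color l)) => [[w h]|h]; first by exists w.
  by exists (x0, 0).
pose fix along t (s : seq nat) := match s with
  | [::] => (x0, 0)
  | b :: s' => if s' is [::] then start b else ref (b, along t s', t) end.
pose bar t s := N (head 0 s, along t s, t).
pose unp k : seq nat := odflt [::] (unpickle k).
pose z k x := \max_(a <- iota 0 k.+1) \max_(b <- iota 0 k.+1)
  bar (pair_below L x a) (unp b).
have [I [g [_ ucI gI]]] := bounded_values z hK n1 ucW.
have /choice[a aP] : forall t, exists a, forall k (s : seq nat), a <= k -> pickle s <= k ->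
    bar t s <= g k.
  move=> [y j]; have [x Ix yx] := lle_uncountable L [:: y] ucI.
  have [a aE] := pair_below_surj j (yx y (mem_head _ _)).
  exists a => k s ak sk; apply: leq_trans (gI k x Ix).
  have ak' : a \in iota 0 k.+1 by rewrite mem_iota.
  have sk' : pickle s \in iota 0 k.+1 by rewrite mem_iota.
  apply: leq_trans (leq_bigmax_seq a ak' isT).
  have := leq_bigmax_seq (P := xpredT) (F := fun b => bar (pair_below L x a) (unp b)) _ sk' isT.
  by rewrite {1}/unp pickleK /= aE.
(* g is taken at an argument above the codes of all final parts of the history,
   as the requirements have started at different steps *)
pose high (s : seq nat) := size s + \max_(m < (size s).+1) pickle (take m s).
have /choice[next nextP] : forall s, exists b, B (head 0 s) b /\ g (high s) <= b.
  by move=> s; have [Binf _ _] := BP (head 0 s); have [b] := Binf (g (high s)); exists b.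
pose l0 := pickle (c x0 0, 0).
pose hist i := iter i (fun s => next s :: s) [:: l0].
have size_hist i : size (hist i) = i.+1 by elim: i => //= i ->.
have inh i : inhabited_color (head 0 (hist i)).
  case: i => [|i] /=; first by exists (x0, 0); rewrite /color decode2K.
  by have [_ Bi _] := BP (head 0 (hist i)); apply: Bi; have [] := nextP (hist i).
pose q t m := along t (take m.+1 (hist (a t + m))).
have hist_head i : hist i = head 0 (hist i) :: behead (hist i) by case: i.
have q_color t m : c (q t m).1 (q t m).2 = color (head 0 (hist (a t + m))) /\
    refinement (head 0 (hist (a t + m.+1))) t (q t m) (q t m.+1).
  have step k : c (q t k).1 (q t k).2 = color (head 0 (hist (a t + k))) ->
      refinement (head 0 (hist (a t + k.+1))) t (q t k) (q t k.+1).
    move=> qc; pose s := take k.+1 (hist (a t + k)).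
    have s_head : head 0 s = head 0 (hist (a t + k)) by rewrite /s hist_head.
    have histS : hist (a t + k.+1) = next (hist (a t + k)) :: hist (a t + k).
      by rewrite addnS.
    have -> : q t k.+1 = ref (head 0 (hist (a t + k.+1)), q t k, t).
      have -> : q t k.+1 = along t (next (hist (a t + k)) :: s) by rewrite /q histS.
      have : s != [::] by rewrite -size_eq0 size_take size_hist; case: ifP.
      by rewrite histS /q -/s; case: (s).
    apply: refP => /=; apply: (NP (head 0 s, q t k, t)); rewrite /= s_head//.
    - rewrite addnS /=; have [_] := nextP (hist (a t + k)); apply: leq_trans.
      rewrite -s_head; apply: aP.
        by rewrite /high size_hist -addSn; apply: leq_trans (leq_addr _ _); rewrite leqW// leq_addr.
      rewrite /high; apply: leq_trans (leq_addl _ _).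
      have kl : k.+1 < (size (hist (a t + k))).+1.
        by rewrite size_hist !ltnS leq_addl.
      exact: (@leq_bigmax _ (fun m : 'I__ => pickle (take m (hist (a t + k)))) (Ordinal kl)).
    - by rewrite addnS /=; have [] := nextP (hist (a t + k)).
  elim: m => [|m [_ IHm]]; last by split; [case: IHm|apply: step; case: IHm].
  suff h : c (q t 0).1 (q t 0).2 = color (head 0 (hist (a t + 0))).
    by split=> //; apply: step.
  rewrite addn0 /q addn0; have := inh (a t); rewrite hist_head /= take0; exact: startP.
have q_le t m m' : m <= m' -> (p (q t m').1 (q t m').2 <= p (q t m).1 (q t m).2)%O.
  move=> /subnKC <-; elim: (m' - m) => [|k IHk]; first by rewrite addn0.
  rewrite addnS; have [_ [_ h _]] := q_color t (m + k).
  exact: Order.POrderTheory.le_trans h IHk.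
exists [set v | exists t m, v = q t m].
  move=> s sG; have [k kP] : exists k, forall i, k <= i -> {in s, forall v, exists w,
      c w.1 w.2 = color (head 0 (hist i)) /\ (p w.1 w.2 <= p v.1 v.2)%O}.
    apply: (@eventually_all _ _ (fun v i => exists w,
      c w.1 w.2 = color (head 0 (hist i)) /\ (p w.1 w.2 <= p v.1 v.2)%O)).
    move=> v /sG[t [m ->]]; exists (a t + m) => i mi; exists (q t (i - a t)); split.
      have [-> _] := q_color t (i - a t); rewrite subnKC//.
      exact: leq_trans (leq_addr _ _) mi.
    by apply: q_le; rewrite -(leq_add2l (a t)) subnKC// (leq_trans (leq_addr m _) mi).
  have /choice[w wP] : forall v, exists w, v \in s ->
      c w.1 w.2 = color (head 0 (hist k)) /\ (p w.1 w.2 <= p v.1 v.2)%O.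
    by move=> v; case: (boolP (v \in s)) => [/(kP k (leqnn k))[w h]|_]; [exists w|exists v].
  have [|r rP] := cc (map w s).
    by move=> _ _ /mapP[v /wP[vc _] ->] /mapP[v' /wP[vc' _] ->]; rewrite vc vc'.
  exists r => _ /mapP[v vs ->]; have [_] := wP v vs; apply: Order.POrderTheory.le_trans.
  by apply: rP; apply: map_f; apply: map_f.
move=> t; exists (q t 1); first by exists t, 1.
by have [_ []] := q_color t 0.
Qed.

End Generic.

(** * Filters *)

Lemma filter_up (d : Order.disp_t) (P : porderType d) (G : set P) :
  G !=set0 -> (forall x y, G x -> G y -> exists2 z, G z & (z <= x)%O /\ (z <= y)%O) ->
  is_filter [set q | exists2 x, G x & (x <= q)%O].
Proof.
move=> [x0 Gx0] Gdir; split=> [q r [x Gx xq] qr|F /finite_seqP[s ->] sG].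
  by exists x => //; apply: Order.POrderTheory.le_trans qr.
suff [x Gx xs] : exists2 x, G x & {in s, forall y, (x <= y)%O}.
  by exists x; [exists x|].
elim: s sG => [|q s IHs] sG; first by exists x0.
have [|x Gx xs] := IHs; first by move=> y ys; apply: sG => /=; rewrite inE (ys : y \in s) orbT.
have [|y Gy yq] := sG q; first by rewrite /= mem_head.
have [z Gz [zx zy]] := Gdir x y Gx Gy; exists z => // r; rewrite inE => /predU1P[->|/xs].
  exact: Order.POrderTheory.le_trans yq.
exact: Order.POrderTheory.le_trans.
Qed.

(** The theorem of Rasiowa and Sikorski. *)
Lemma countable_generic (d : Order.disp_t) (P : porderType d) (X : set (set P)) :
  inhabited P -> countable X -> (forall D, X D -> dense_below D) ->
  exists2 G : set P, is_filter G & forall D, X D -> G `&` D !=set0.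
Proof.
move=> [p0] /countable_injP[f finj] Xd.
have /choice[E EP] : forall j, exists D : set P, dense_below D /\
    forall D', X D' -> f D' = j -> D' = D.
  move=> j; case: (pselect (exists2 D, X D & f D = j)) => [[D XD fD]|nD].
    exists D; split; first exact: Xd.
    by move=> D' XD' fD'; apply: finj; rewrite ?inE// fD.
  exists setT; split; first by move=> q; exists q.
  by move=> D' XD' fD'; case: nD; exists D'.
have /choice[g gP] : forall jq : nat * P, exists r, E jq.1 r /\ (r <= jq.2)%O.
  by move=> [j q]; have [/(_ q)[r]] := EP j; exists r.
pose q := fix q j := if j is i.+1 then g (i, q i) else p0.
have q_le i j : i <= j -> (q j <= q i)%O.
  move=> /subnKC <-; elim: (j - i) => [|k IHk]; first by rewrite addn0.
  by rewrite addnS; have [_ h] := gP (i + k, q (i + k)); apply: Order.POrderTheory.le_trans IHk.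
exists [set r | exists2 x, range q x & (x <= r)%O].
  apply: filter_up; first by exists (q 0), 0.
  move=> _ _ [i _ <-] [j _ <-]; exists (q (maxn i j)); first by exists (maxn i j).
  by rewrite !q_le// leq_max leqnn ?orbT.
move=> D XD; have [_ /(_ _ XD erefl) ->] := EP (f D); exists (q (f D).+1).
split; last by have [] := gP (f D, q (f D)).
by exists (q (f D).+1) => //; exists (f D).+1.
Qed.

(** A Loewenheim closure.  The terms are trees: a node [0] stands for a chosen
    lower bound of the values of the subtrees, and a node [j.+1] for a chosen
    element below them of the [j]-th dense set below [u].  The values at [u]
    are thus closed under these operations, and they increase with [u], as a
    term can be translated from [u] to any [x] above [u]. *)
Lemma countable_closures (d : Order.disp_t) (P : porderType d) (W : choiceType)
  (L : ladder W) (x0 : W) (E : W -> set P) (p0 : P) : (forall y, dense_below (E y)) ->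
  exists2 p : W -> nat -> P, lower_bounds_closed p &
    forall y (v : W * nat), exists2 w : W * nat,
      (p w.1 w.2 <= p v.1 v.2)%O & E y (p w.1 w.2).
Proof.
move=> Ed.
have /choice[lb lbP] : forall s : seq P, exists q, bounded s -> {in s, forall x, (q <= x)%O}.
  move=> s; case: (pselect (bounded s)) => [[q qs]|nb]; first by exists q.
  by exists p0.
have /choice[g gP] : forall yq : W * P, exists r, E yq.1 r /\ (r <= yq.2)%O.
  by move=> [y q]; have [r] := Ed y q; exists r.
pose ev u := fix ev (t : GenTree.tree nat) := match t with
  | GenTree.Leaf _ => p0
  | GenTree.Node 0 ts => lb (map ev ts)
  | GenTree.Node j.+1 ts => g (enum_below L u j, head p0 (map ev ts)) end.
pose tr (f : nat -> nat) := fix tr (t : GenTree.tree nat) := match t with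
  | GenTree.Leaf j => GenTree.Leaf j
  | GenTree.Node 0 ts => GenTree.Node 0 (map tr ts)
  | GenTree.Node j.+1 ts => GenTree.Node (f j).+1 (map tr ts) end.
have evtr u x f : (forall j, enum_below L x (f j) = enum_below L u j) ->
    forall t, ev x (tr f t) = ev u t.
  move=> fE; elim=> [//|j ts IH].
  have mE : map (ev x) (map (tr f) ts) = map (ev u) ts.
    by rewrite -map_comp; elim: ts IH => //= t ts IHts [-> /IHts ->].
  by case: j => [|j]; [congr (lb _)|rewrite /= fE; congr (g (_, head _ _))].
have mono u x t : lle L u x -> exists t', ev x t' = ev u t.
  move=> ux; have /choice[f fE] : forall j, exists i, enum_below L x i = enum_below L u j.
    by move=> j; apply: enum_below_surj; apply: lle_trans ux; apply: enum_belowP.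
  by exists (tr f t); apply: evtr.
pose p u i := ev u (odflt (GenTree.Leaf 0) (unpickle i)).
have pE u t : p u (pickle t) = ev u t by rewrite /p pickleK.
exists p => [s|y [u i]]; last first.
  pose x := if lle L u y then y else u.
  have [ux yx] : lle L u x /\ lle L y x.
    rewrite /x; case: ifP => uy; first by rewrite lle_refl.
    by have := lle_total L u y; rewrite uy lle_refl.
  have [t tE] := mono u x (odflt (GenTree.Leaf 0) (unpickle i)) ux.
  have [j jE] := enum_below_surj yx.
  exists (x, pickle (GenTree.Node j.+1 [:: t])); rewrite /= pE /= tE jE.
    by have [] := gP (y, p u i).
  by have [] := gP (y, p u i).
case: (eqVneq s [::]) => [->|s0 sb]; first by exists (x0, 0).
have [|x xs xmax] := exists_lle_max L (s := [seq v.1 | v <- s]); first by case: (s) s0.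
have /choice[t tP] : forall v : W * nat, exists t, v \in s -> ev x t = p v.1 v.2.
  move=> v; case: (boolP (v \in s)) => [vs|_]; last by exists (GenTree.Leaf 0).
  by have [t tE] := mono v.1 x (odflt (GenTree.Leaf 0) (unpickle v.2))
    (xmax _ (map_f _ vs)); exists t.
have sE : map (ev x) (map t s) = [seq p v.1 v.2 | v <- s].
  by rewrite -map_comp; apply/eq_in_map => v /tP.
exists (x, pickle (GenTree.Node 0 (map t s))) => v vs; rewrite /= pE /= sE.
by apply: (lbP _ sb); apply: map_f.
Qed.

(** Besides the given dense sets, each pair of elements [p v] and [p w] gives a
    requirement: to be below both, or incompatible with one of them.  In a
    centered set only the first case is possible, so that a centered set which
    meets these requirements is directed. *)
Definition requirement (d : Order.disp_t) (P : porderType d) (W : choiceType)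
    (L : ladder W) (p : W -> nat -> P) (E : W -> set P) (t : W * nat) : set P :=
  if t.2 is i.+1 then
    let v := pair_below L t.1 (decode2 i).1 in let w := pair_below L t.1 (decode2 i).2 in
    [set r | [/\ (r <= p v.1 v.2)%O & (r <= p w.1 w.2)%O] \/
      (~ bounded [:: r; p v.1 v.2] \/ ~ bounded [:: r; p w.1 w.2])]
  else [set r | exists2 q, E t.1 q & (r <= q)%O].

Lemma requirement_open (d : Order.disp_t) (P : porderType d) (W : choiceType)
    (L : ladder W) (p : W -> nat -> P) (E : W -> set P) t q r :
  requirement L p E t q -> (r <= q)%O -> requirement L p E t r.
Proof.
have mono x : (r <= q)%O -> bounded [:: r; x] -> bounded [:: q; x].
  move=> rq [z zs]; exists z => y; rewrite !inE => /orP[] /eqP ->.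
    by apply: Order.POrderTheory.le_trans (zs r _) rq; rewrite mem_head.
  by apply: zs; rewrite !inE eqxx orbT.
case: t => y [|i]; rewrite /requirement /=.
  by move=> [z Ez qz] rq; exists z => //; apply: Order.POrderTheory.le_trans qz.
move=> [[qv qw]|[nb|nb]] rq.
- by left; split; apply: Order.POrderTheory.le_trans rq _.
- by right; left => /(mono _ rq).
- by right; right => /(mono _ rq).
Qed.

Lemma requirement_dense (d : Order.disp_t) (P : porderType d) (W : choiceType)
    (L : ladder W) (p : W -> nat -> P) (E : W -> set P) :
  lower_bounds_closed p ->
  (forall y (v : W * nat), exists2 w : W * nat,
      (p w.1 w.2 <= p v.1 v.2)%O & E y (p w.1 w.2)) ->
  forall t (v : W * nat), exists2 w : W * nat,
    (p w.1 w.2 <= p v.1 v.2)%O & requirement L p E t (p w.1 w.2).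
Proof.
move=> plb Ed [y [|i]] v; rewrite /requirement /=.
  by have [w wv Ew] := Ed y v; exists w => //; exists (p w.1 w.2).
pose a := pair_below L y (decode2 i).1; pose b := pair_below L y (decode2 i).2.
have meet u u' : bounded [:: p u.1 u.2; p u'.1 u'.2] ->
    exists2 w : W * nat, (p w.1 w.2 <= p u.1 u.2)%O & (p w.1 w.2 <= p u'.1 u'.2)%O.
  by move=> /(plb [:: u; u'])[w ws]; exists w; apply: ws; rewrite !inE eqxx ?orbT.
case: (pselect (bounded [:: p v.1 v.2; p a.1 a.2])) => [/meet[w wv wa]|nb]; last first.
  by exists v => //; right; left.
case: (pselect (bounded [:: p w.1 w.2; p b.1 b.2])) => [/meet[u uw ub]|nb]; last first.
  by exists w => //; right; right.
exists u; first exact: Order.POrderTheory.le_trans wv.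
by left; split=> //; apply: Order.POrderTheory.le_trans wa.
Qed.

Lemma uncountable_generic n (d : Order.disp_t) (P : porderType d) (W : choiceType)
  (L : ladder W) (E : W -> set P) : K_step n -> 1 < n -> property_K n P ->
  ~ countable [set: W] -> inhabited P -> (forall y, dense_below (E y)) ->
  exists2 G : set P, is_filter G & forall y, G `&` E y !=set0.
Proof.
move=> hK n1 KP ucW [p0] Ed; have [x0 _] := uncountable_ex ucW.
have [p plb pE] := countable_closures L x0 p0 Ed.
have [c cc] := sigma_centered L hK n1 KP ucW plb.
have [G Gb GD] := generic L (@requirement_open _ _ _ L p E)
  (requirement_dense L plb pE) hK n1 ucW cc plb.
exists [set q | exists2 x, [set p v.1 v.2 | v in G] x & (x <= q)%O].
  apply: filter_up.
    by have [v Gv _] := GD (x0, 0); exists (p v.1 v.2), v.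
  move=> _ _ [v Gv <-] [w Gw <-].
  have [x [vx wx]] : exists x, lle L v.1 x /\ lle L w.1 x.
    by have /orP[h|h] := lle_total L v.1 w.1; [exists w.1|exists v.1]; rewrite lle_refl.
  have [[a aE] [b bE]] := (pair_below_surj v.2 vx, pair_below_surj w.2 wx).
  have pv : p v.1 v.2 = p (pair_below L x a).1 (pair_below L x a).2 by rewrite aE.
  have pw : p w.1 w.2 = p (pair_below L x b).1 (pair_below L x b).2 by rewrite bE.
  have [u Gu] := GD (x, (pickle (a, b)).+1); rewrite /requirement /= decode2K /=.
  have ub z : G z -> bounded [:: p u.1 u.2; p z.1 z.2].
    by move=> Gz; apply: (Gb [:: u; z]) => y; rewrite !inE => /orP[] /eqP ->.
  case=> [|[nb|nb]].
  - by rewrite pv pw => h; exists (p u.1 u.2); first exists u.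
  - by case: nb; have := ub v Gv; rewrite pv.
  - by case: nb; have := ub w Gw; rewrite pw.
move=> y; have [v Gv [q Eq vq]] := GD (y, 0); exists q; split=> //.
by exists (p v.1 v.2) => //; exists v.
Qed.

Theorem theorem2 (n : nat) (hn : 2 <= n)
    (hK : forall (d : Order.disp_t) (P : porderType d),
      property_K n P -> property_K n.+1 P) :
  MA_omega1 (property_K n).
Proof.
move=> d P P0 KP X [R Rwo Rc] Xd.
case: (pselect (countable X)) => [cX|ucX]; first exact: countable_generic.
pose W : choiceType := {classic {D : set P | X D}}.
pose val (y : W) : set P := sval (y : {D : set P | X D}).
have val_inj : injective val.
  by move=> [D XD] [D' XD'] /= h; apply: eq_exist.
have Xval y : X (val y) by case: y.
pose S : rel W := fun x y => R (val x) (val y).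
have Swo : wochoice.well_order S.
  move=> A [x xA].
  pose B : {pred set P} := [pred D | `[< exists2 y, y \in A & val y = D >]].
  have [|D [[/asboolP[y yA yD] Dmin] Duniq]] := Rwo B.
    by exists (val x); apply/asboolP; exists x.
  have lowB z : wochoice.minimum_of S A z -> wochoice.minimum_of R B (val z).
    move=> [zA zmin]; split; first by apply/asboolP; exists z.
    by move=> _ /asboolP[u uA <-]; apply: zmin.
  exists y; split; last by move=> z /lowB/Duniq; rewrite -yD => /val_inj.
  split=> // z zA; rewrite /S yD; apply: Dmin; apply/asboolP; by exists z.
have Sc x : countable [set y | S y x].
  apply: contrapT => uc; apply: (uncountable_image (f := val) _ uc).
    by move=> y z _ _; apply: val_inj.
  by apply: sub_countable (Rc _ (Xval x)); apply: subset_card_le => _ [y yx <-].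
have ucW : ~ countable [set: W].
  move=> cW; apply: ucX; apply: sub_countable cW.
  apply: card_le_trans (card_image_le val setT).
  by apply: subset_card_le => D XD; exists (exist _ D XD).
have [L _] := ladder_exists Swo Sc.
have [G Gf GE] := uncountable_generic L hK hn KP ucW P0 (fun y => Xd _ (Xval y)).
by exists G => // D XD; apply: (GE (exist _ D XD)).
Qed.
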